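(* For all $d,m\in\mathbb{N}$ with $d\ge m$, there exists a constant $C(d,m)$, depending only on $d$ and $m$, such that for every $n\in\mathbb{N}$, for any probability measures $\nu_1,\ldots,\nu_n$ on $\mathbb{R}$, each $\nu_j$ having a density $\varrho_j$ of bounded variation, and for any non-constant polynomial $f\in\mathcal{P}_{d,m}(\mathbb{R}^n)$, one has $$\sigma\bigl((\otimes_{j=1}^n\nu_j)\circ f^{-1},\varepsilon\bigr)\le C(d,m)\bigl(1+\max_{1\le j\le n}\|\varrho_j\|_{\dot{BV}(\mathbb{R})}\bigr)^{d/m}[f]_\infty^{-1/m}\,\varepsilon^{1/m}\bigl(|\ln([f]_\infty^{-1}\varepsilon)|^{d-m}+1\bigr)$$ for every $\varepsilon>0$.
   Context: $\mathbb{N}=\{1,2,\dots\}$. $\mathcal{P}_{d,m}(\mathbb{R}^n)$ is the space of all real polynomials in $n$ variables of total degree at most $d$ whose degree in each individual variable is at most $m$, i.e. $f(x)=\sum_{j_1+\ldots+j_n\le d,\ \max_i j_i\le m}a_{j_1,\ldots,j_n}x_1^{j_1}\cdots x_n^{j_n}$. For such $f$ put $$d(f):=\max\{j_1+\ldots+j_n:\ a_{j_1,\ldots,j_n}\ne0\},\qquad [f]_\infty:=\max\{|a_{j_1,\ldots,j_n}|:\ j_1+\ldots+j_n=d(f)\}.$$ $\mu\circ f^{-1}$ is the image measure of $\mu$ under $f$. $C_b^\infty(\mathbb{R})$ is the space of bounded smooth real functions with bounded derivatives of every order, $\|\cdot\|_\infty$ is the sup-norm. For a bounded Borel measure $\nu$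 on $\mathbb{R}$ and $\varepsilon>0$, $$\sigma(\nu,\varepsilon):=\sup\Bigl\{\int_{\mathbb{R}}\varphi'(t)\,\nu(dt):\ \varphi\in C_b^\infty(\mathbb{R}),\ \|\varphi\|_\infty\le\varepsilon,\ \|\varphi'\|_\infty\le1\Bigr\}.$$ For $\varrho\in L^1(\mathbb{R})$, $\|\varrho\|_{\dot{BV}(\mathbb{R})}:=\sup_{\varepsilon>0}\varepsilon^{-1}\sup_{|h|\le\varepsilon}\int_{\mathbb{R}}|\varrho(x+h)-\varrho(x)|\,dx$, and $\varrho$ is of bounded variation if this is finite. *)

(* Defs.v *)
From HB Require Import structures.
From mathcomp Require Import all_boot all_order all_algebra.
(* The notations of mpoly are incompatible with those of MathComp-Analysis. *)
From mathcomp Require Import -(notations) mpoly.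
From mathcomp Require Import all_classical all_reals all_analysis.
From mathcomp Require Import measurable_realfun.

Set Implicit Arguments.
Unset Strict Implicit.
Unset Printing Implicit Defensive.

Import Order.TTheory GRing.Theory Num.Theory.
Import numFieldNormedType.Exports.

Local Open Scope classical_set_scope.
Local Open Scope ring_scope.

Section mpoly_class.
Context {R : realType} {n : nat}.
Implicit Type f : mpoly n R.

Definition mpoly_degree f : nat := (\max_(j <- msupp f) mdeg j)%N.

(* the space P_{d,m}(R^n) *)
Definition mpoly_dm (d m : nat) : set (mpoly n R) :=
  [set f | forall j, j \in msupp f ->
    (mdeg j <= d)%N /\ forall i, (j i <= m)%N].

(* the seq is only empty for f = 0, and then the value is 0 *)
Definition top_coef_norm f : R :=
  \big[Num.max/0]_(j <- msupp f | mdeg j == mpoly_degree f)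
    `|mcoeff j f|.

Definition mpoly_fun f (x : n.-tuple (measurableTypeR R)) : measurableTypeR R :=
  meval (tnth x) f.

Lemma measurable_mpoly_fun f : measurable_fun [set: _] (mpoly_fun f).
Proof.
rewrite /mpoly_fun; under eq_fun do rewrite mevalE.
apply: (@measurable_sum _ _ R) => j; apply: measurable_funM => //.
apply: (@measurable_prod _ _ R) => i _; apply: measurable_funX.
exact: measurable_tnth.
Qed.

HB.instance Definition _ f :=
  isMeasurableFun.Build _ _ _ _ (mpoly_fun f) (measurable_mpoly_fun f).

End mpoly_class.

Section prod2_probability.
Context d1 d2 (T1 : measurableType d1) (T2 : measurableType d2) (R : realType).
Variables (P : probability T1 R) (Q : probability T2 R).

Definition prod2 : set (T1 * T2) -> \bar R := (P \x Q)%E.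

HB.instance Definition _ := Measure.on prod2.

Let prod2_setT : prod2 setT = 1%E.
Proof.
rewrite -setXTT [LHS]product_measure1E//.
rewrite -[X in _ = X]mule1; congr (_ * _)%E; exact: probability_setT.
Qed.

HB.instance Definition _ :=
  Measure_isProbability.Build _ _ _ prod2 prod2_setT.

End prod2_probability.

Section product_probability.
Context {d} {T : measurableType d} {R : realType}.

Definition pair_cons n (x : T * n.-tuple T) : n.+1.-tuple T :=
  [tuple of x.1 :: x.2].

Lemma measurable_pair_cons n : measurable_fun [set: _] (@pair_cons n).
Proof. exact: (measurable_cons measurable_fst measurable_snd). Qed.

HB.instance Definition _ n :=
  isMeasurableFun.Build _ _ _ _ (@pair_cons n) (@measurable_pair_cons n).

(* the product of P 0, ..., P (n - 1); see product_probability_box *)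
Fixpoint product_probability n :
    ('I_n -> probability T R) -> probability (n.-tuple T) R :=
  match n with
  | 0 => fun=> \d_([tuple] : 0.-tuple T)
  | n'.+1 => fun P => distribution (prod2 (P ord0)
      (product_probability (fun i : 'I_n' => P (lift ord0 i)))) (@pair_cons n')
  end.

Lemma product_probability_box n (P : 'I_n -> probability T R)
    (A : 'I_n -> set T) : (forall i, measurable (A i)) ->
  product_probability P [set x | forall i, A i (tnth x i)] =
  (\prod_(i < n) P i (A i))%E.
Proof.
elim: n P A => [|n IHn] P A mA /=.
  by rewrite big_ord0 diracE mem_set// => -[].
have mB : measurable [set x : n.-tuple T |
    forall i, A (lift ord0 i) (tnth x i)].
  rewrite [X in measurable X](_ : _ =
      \bigcap_(i in [set: 'I_n]) (@tnth n T ^~ i) @^-1` A (lift ord0 i)).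
    apply: fin_bigcap_measurable => // i _.
    rewrite -[X in measurable X]setTI.
    exact: measurable_tnth.
  by apply/seteqP; split => [x /= h i _|x h i]; exact: h.
rewrite big_ord_recl -IHn//.
transitivity (prod2 (P ord0) (product_probability (fun i => P (lift ord0 i)))
  (A ord0 `*` [set x : n.-tuple T |
    forall i, A (lift ord0 i) (tnth x i)])).
  rewrite /distribution /pushforward; congr (_ _).
  apply/seteqP; split => -[x y] /=.
    move=> h; split; first by have := h ord0; rewrite tnth0.
    by move=> i; have := h (lift ord0 i); rewrite tnthS.
  move=> [h0 h] i; case: (unliftP ord0 i) => [j|] ->; rewrite ?tnth0//.
  by rewrite tnthS.
exact: product_measure1E.
Qed.

End product_probability.

Section one_dimensional.
Context {R : realType}.

(* rho >= 0 almost everywhere is a consequence, its integrals being values of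
   the measure nu *)
Definition has_density (nu : probability (measurableTypeR R) R)
    (rho : R -> R) : Prop :=
  lebesgue_measure.-integrable [set: measurableTypeR R] (EFin \o rho) /\
  forall A : set (measurableTypeR R), measurable A ->
    nu A = (\int[lebesgue_measure]_(x in A) (rho x)%:E)%E.

Definition BV_norm (rho : R -> R) : \bar R :=
  ereal_sup [set (eps^-1%:E * ereal_sup
    [set \int[lebesgue_measure]_x `|rho (x + h) - rho x|%:E
      | h in [set h : R | (`|h| <= eps)%R]])%E
    | eps in [set eps : R | 0 < eps]].

Definition is_BV (rho : R -> R) : Prop := (BV_norm rho < +oo)%E.

Definition Cb_infty : set (R -> R) :=
  [set phi | (forall k x, derivable (derive1n k phi) x 1) /\
    forall k, exists M, forall x, `|derive1n k phi x| <= M].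

Definition sup_norm (phi : R -> R) : \bar R :=
  ereal_sup (range (fun x => `|phi x|%:E)).

Definition sigma_modulus (nu : {finite_measure set (measurableTypeR R) -> \bar R})
    (eps : R) : \bar R :=
  ereal_sup [set (\int[nu]_t (derive1 phi t)%:E)%E | phi in
    [set phi | [/\ Cb_infty phi, (sup_norm phi <= eps%:E)%E
      & (sup_norm (derive1 phi) <= 1)%E]]].

End one_dimensional.

(* Main.v *)
(* Integrating out one coordinate [i] reduces an expectation of [phi' (f x)] to
   one-variable oscillatory integrals of [phi' (p t)], [p] of degree at most
   [m]: away from the set where [p'] is small, [phi' (p t)] is integrated by
   parts, and a Remez inequality makes that set short.  What remains are
   sublevel probabilities of [mderiv i f], a polynomial of degree [d - 1] whose
   top coefficients are still large, and these are again expectations of some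
   [phi' (mderiv i f x)] (take [phi] an arctangent), hence an induction on [d].
   While [d] equals the bound [m] on the partial degrees, both decrease by one
   and a single threshold for [p'] gives the exponent [1 / m].  For [d > m] only
   [d] decreases, the thresholds range over a geometric scale between [eps] and
   the top coefficient, and each of them contributes the same amount: this is one
   more logarithm per step.

   The densities enter only through the property [spread l], [l] being of order
   [1 / (1 + max BV_norm)]: a law of bounded variation integrates test functions
   as a signed mixture, of bounded total mass, of uniform laws on intervals of
   length at most [l].  Uniform laws on intervals of length [l] have this property
   as well, so the law of the distinguished coordinate can be replaced by one in
   the induction. *)
From HB Require Import structures.
Require Import Defs.
From mathcomp Require Import all_boot all_order all_algebra.
From mathcomp Require Import -(notations) mpoly.
From mathcomp Require Import all_classical all_reals all_analysis.
From mathcomp Require Import measurable_realfun ring lra zify.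

Set Implicit Arguments.
Unset Strict Implicit.
Unset Printing Implicit Defensive.

Import Order.TTheory GRing.Theory Num.Theory.
Import numFieldNormedType.Exports.

Local Open Scope classical_set_scope.
Local Open Scope ring_scope.

(** * One-variable oscillatory integrals *)

Section increments.
Context {R : realType}.
Implicit Types (F G H phi : R -> R) (p q r : {poly R}).

Lemma is_derive_continuous F (x dF : R) :
  is_derive x 1 F dF -> {for x, continuous F}.
Proof. by move=> dFx; apply/differentiable_continuous/derivable1_diffP. Qed.

Lemma is_derive_horner p (x : R) : is_derive x 1 (horner p) p^`().[x].
Proof.
apply: DeriveDef; first exact: derivable_horner.
by rewrite -derive1E derivE.
Qed.

Lemma continuous_horner p : continuous (horner p).
Proof. by move=> x; apply: is_derive_continuous (is_derive_horner p x). Qed.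

Lemma le_increment F G (dF dG : R -> R) (a b : R) : a <= b ->
  (forall x : R, a <= x <= b -> is_derive x 1 F (dF x)) ->
  (forall x : R, a <= x <= b -> is_derive x 1 G (dG x)) ->
  (forall x, a < x < b -> dF x <= dG x) -> F b - F a <= G b - G a.
Proof.
rewrite le_eqVlt => /predU1P[-> _ _ _|ab dFE dGE dFG]; first by rewrite !subrr.
have dGF (x : R) : a <= x <= b -> is_derive x 1 (G - F) (dG x - dF x).
  by move=> xab; have := dFE _ xab; have := dGE _ xab => ? ?; apply: is_deriveB.
have [||c] := @MVT R (G - F) (fun x => dG x - dF x) a b ab.
- by move=> x; rewrite in_itv/= => /andP[? ?]; apply: dGF; rewrite !ltW.
- apply: derivable_within_continuous => x; rewrite in_itv/= => xab.
  by have [] := dGF _ xab.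
rewrite in_itv/= => cab /=; rewrite !fctE => E; rewrite -subr_ge0.
suff : 0 <= (dG c - dF c) * (b - a) by rewrite -E; lra.
by rewrite mulr_ge0// subr_ge0 ?dFG// ltW//; case/andP: cab.
Qed.

Lemma normr_increment_le F (dF : R -> R) (a b : R) : a <= b ->
  (forall x : R, is_derive x 1 F (dF x)) -> (forall x, `|dF x| <= 1) ->
  `|F b - F a| <= b - a.
Proof.
move=> ab FE dF1.
have [|c _ ->] := @MVT_segment R F dF a b ab.
  by apply: derivable_within_continuous => x _; have [] := FE x.
by rewrite normrM (ger0_norm (x := b - a)) ?subr_ge0// ler_piMl// subr_ge0.
Qed.

Section monotone_piece.
Variables (p : {poly R}) (phi dphi G : R -> R) (eps delta : R).
Hypotheses (phiE : forall u : R, is_derive u 1 phi (dphi u))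
  (phi_le : forall u, `|phi u| <= eps) (delta_gt0 : 0 < delta)
  (GE : forall t : R, is_derive t 1 G (dphi p.[t])).

Let is_derive_quotient (c t : R) : p^`().[t] != 0 ->
  is_derive t 1 (fun t => (phi p.[t] + c) / p^`().[t])
    (dphi p.[t] - (phi p.[t] + c) * p^`()^`().[t] / p^`().[t] ^+ 2).
Proof.
move=> qt0.
have h1 := is_derive_horner p t.
have h2 := is_derive_horner p^`() t.
have h3 : is_derive t 1 (phi \o horner p) (dphi p.[t] * p^`().[t]).
  by apply: is_derive1_comp; exact: phiE.
have h4 : is_derive t 1 ((phi \o horner p) + cst c) (dphi p.[t] * p^`().[t] + 0).
  exact: is_deriveD.
have h5 : is_derive t 1 (fun t => p^`().[t]^-1)
    (- p^`().[t] ^- 2 *: p^`()^`().[t]).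
  exact: is_deriveV.
have h6 := is_deriveM h4 h5.
apply: (is_derive_eq h6).
rewrite !fctE /= /GRing.scale /=.
by field.
Qed.

Let quotient_increment_le (c a b : R) : `|c| <= eps ->
  delta <= `|p^`().[a]| -> delta <= `|p^`().[b]| ->
  `|(phi p.[b] + c) / p^`().[b] - (phi p.[a] + c) / p^`().[a]| <=
    4 * (eps / delta).
Proof.
move=> ce qa qb.
have eps_ge0 : 0 <= eps by apply: le_trans ce.
have bnd t : delta <= `|p^`().[t]| ->
    `|(phi p.[t] + c) / p^`().[t]| <= 2 * (eps / delta).
  move=> qt; rewrite normrM normfV mulrA ler_pM ?invr_ge0//.
    by rewrite (le_trans (ler_normD _ _))// mulr_natl mulr2n lerD.
  by rewrite lef_pV2// posrE// (lt_le_trans delta_gt0).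
rewrite (le_trans (ler_normB _ _))// (le_trans (lerD (bnd _ qb) (bnd _ qa)))//.
by lra.
Qed.

(* [G] is squeezed between the increments of [(phi p + eps) / p'] and of
   [(phi p - eps) / p'] *)
Lemma normr_increment_le_monotone (a b : R) : a <= b ->
  (forall t, a <= t <= b -> delta <= `|p^`().[t]|) ->
  (forall t, a <= t <= b -> 0 <= p^`()^`().[t]) \/
  (forall t, a <= t <= b -> p^`()^`().[t] <= 0) ->
  `|G b - G a| <= 4 * (eps / delta).
Proof.
move=> ab qge q'sg.
have q0 t : a <= t <= b -> p^`().[t] != 0.
  by move=> /qge; rewrite -normr_gt0; exact: lt_le_trans.
have eps_ge0 : 0 <= eps by apply: le_trans (phi_le 0).
(* The shift [c] is [eps] with the sign of [p'']: [(phi p + c) p''] is then nonnegative and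
   [(phi p - c) p''] nonpositive, so the error term in the derivative of the quotient has a known
   sign for both shifts. *)
have [c [ce clo chi]] : exists c, [/\ `|c| <= eps,
    forall t, a <= t <= b -> 0 <= (phi p.[t] + c) * p^`()^`().[t] &
    forall t, a <= t <= b -> (phi p.[t] - c) * p^`()^`().[t] <= 0].
  case: q'sg => q'sg; [exists eps|exists (- eps)].
  - split=> [|t tab|t tab]; first by rewrite ger0_norm.
      rewrite mulr_ge0// ?q'sg//.
      by have := phi_le p.[t]; rewrite ler_norml => /andP[]; lra.
    rewrite mulr_le0_ge0// ?q'sg//.
    by have := phi_le p.[t]; rewrite ler_norml => /andP[]; lra.
  - split=> [|t tab|t tab]; first by rewrite normrN ger0_norm.
      rewrite mulr_le0// ?q'sg//.
      by have := phi_le p.[t]; rewrite ler_norml => /andP[]; lra.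
    rewrite mulr_ge0_le0// ?q'sg//.
    by have := phi_le p.[t]; rewrite ler_norml => /andP[]; lra.
have aab : a <= a <= b by rewrite lexx.
have bab : a <= b <= b by rewrite lexx andbT.
have cN : `|- c| <= eps by rewrite normrN.
have := quotient_increment_le ce (qge _ aab) (qge _ bab).
have := quotient_increment_le cN (qge _ aab) (qge _ bab).
rewrite !ler_norml => /andP[_ hi] /andP[lo _]; apply/andP; split.
  apply: (le_trans lo).
  apply: (le_increment ab (fun t tab => is_derive_quotient c (q0 _ tab))
    (fun t _ => GE t)) => t /andP[at_ tb].
  have tab : a <= t <= b by rewrite !ltW.
  by rewrite lerBlDr lerDl mulr_ge0 ?clo// invr_ge0 exprn_even_ge0.
apply: le_trans hi.
apply: (le_increment ab (fun t _ => GE t)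
  (fun t tab => is_derive_quotient (- c) (q0 _ tab))) => t /andP[at_ tb].
have tab : a <= t <= b by rewrite !ltW.
by rewrite lerBrDr gerDl mulr_le0_ge0 ?chi// invr_ge0 exprn_even_ge0.
Qed.

End monotone_piece.

End increments.

(** * Root splitting and a Remez inequality for univariate polynomials *)

Section one_variable_polynomials.
Context {R : realType}.
Implicit Types (G H : R -> R) (p q r : {poly R}).

Lemma horner_sign_itv r (a b : R) : (forall t, a < t < b -> ~~ root r t) ->
  (forall t, a <= t <= b -> 0 <= r.[t]) \/
  (forall t, a <= t <= b -> r.[t] <= 0).
Proof.
move=> nr; apply: contrapT => /not_orP[/existsNP[t1] /not_implyP[t1ab /negP]].
rewrite -ltNge => r1 /existsNP[t2] /not_implyP[t2ab /negP].
rewrite -ltNge => r2.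
case/andP: t1ab => at1 t1b; case/andP: t2ab => at2 t2b.
have [t12|t21] := leP t1 t2.
- have [|x /andP[t1x xt2] rx] := @poly_ivt _ r _ _ t12; first by rewrite !ltW.
  (* The root could be an end point only by coinciding with [t1] or [t2], where [r] does not
     vanish. *)
  suff xab : a < x < b by have := nr _ xab; rewrite rx.
  apply/andP; split.
    rewrite lt_neqAle (le_trans at1)// andbT; apply/eqP => ax.
    move: rx; rewrite rootE -ax => /eqP r0.
    have t1a : t1 = a by apply/le_anti; rewrite at1 ax t1x.
    by move: r1; rewrite t1a r0 ltxx.
  rewrite lt_neqAle (le_trans xt2)// andbT; apply/eqP => xb.
  move: rx; rewrite rootE xb => /eqP r0.
  have t2b' : t2 = b by apply/le_anti; rewrite t2b -xb xt2.
  by move: r2; rewrite t2b' r0 ltxx.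
- have [|x /andP[t2x xt1] rx] := @poly_ivt _ (- r) _ _ (ltW t21).
    by rewrite !hornerN oppr_le0 oppr_ge0 !ltW.
  rewrite rootN in rx.
  suff xab : a < x < b by have := nr _ xab; rewrite rx.
  apply/andP; split.
    rewrite lt_neqAle (le_trans at2)// andbT; apply/eqP => ax.
    move: rx; rewrite rootE -ax => /eqP r0.
    have t2a : t2 = a by apply/le_anti; rewrite at2 ax t2x.
    by move: r2; rewrite t2a r0 ltxx.
  rewrite lt_neqAle (le_trans xt1)// andbT; apply/eqP => xb.
  move: rx; rewrite rootE xb => /eqP r0.
  have t1b' : t1 = b by apply/le_anti; rewrite t1b -xb xt1.
  by move: r1; rewrite t1b' r0 ltxx.
Qed.

(** Cut at an interior root and divide it out: each cut at most doubles the number of error terms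
    [c], while the increments of [H] telescope. The count [2 ^ k] is crude, but depends only on the
    degree. *)
Lemma increment_split_roots k r G H (c a b : R) : (size r <= k.+1)%N ->
  r != 0 -> 0 <= c -> a <= b ->
  (forall x y, a <= x -> x <= y -> y <= b ->
    (forall t, x < t < y -> ~~ root r t) ->
    `|G y - G x| <= c + (H y - H x)) ->
  `|G b - G a| <= c *+ (2 ^ k) + (H b - H a).
Proof.
move=> + + c0; elim: k r a b => [|k IH] r a b.
  rewrite expn0 mulr1n => sr r0 ab; apply => // t _.
  rewrite -size_poly_gt0 in r0.
  have /eqP sr1 : size r == 1 by rewrite eqn_leq sr r0.
  by apply/negP => /eqP; move/eqP: sr1 => /size_poly1P[d d0 ->]; rewrite hornerC; exact/eqP.
move=> sr r0 ab hG.
have c_le : c <= c *+ (2 ^ k.+1) by rewrite -{1}(mulr1n c) ler_wpMn2l// expn_gt0.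
have [[x xab rx]|nx] := pselect (exists2 x, a < x < b & root r x); last first.
  rewrite (le_trans (hG a b _ _ _ _))// ?lerD2r// => t tab.
  by apply/negP => rt; apply: nx; exists t.
case/andP: xab => ax xb.
have /factor_theorem[r' r'E] := rx.
have r'0 : r' != 0 by apply: contraNneq r0 => r'0; rewrite r'E r'0 mul0r.
have sr' : (size r' <= k.+1)%N.
  by move: sr; rewrite r'E size_Mmonic ?monicXsubC// size_XsubC addn2.
have h1 : `|G x - G a| <= c *+ (2 ^ k) + (H x - H a).
  apply: (IH r') => //; first exact: ltW.
  move=> y z ay yz zx nr; apply: hG => //; first by rewrite (le_trans zx)// ltW.
  move=> t /andP[yt tz]; rewrite r'E rootM negb_or nr ?yt//= root_XsubC.
  by rewrite lt_eqF// (lt_le_trans tz).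
have h2 : `|G b - G x| <= c *+ (2 ^ k) + (H b - H x).
  apply: (IH r') => //; first exact: ltW.
  move=> y z xy yz zb nr; apply: hG => //; first by rewrite (le_trans (ltW ax)).
  move=> t /andP[yt tz]; rewrite r'E rootM negb_or nr ?yt//= root_XsubC.
  by rewrite gt_eqF// (le_lt_trans xy).
rewrite expnS mul2n -addnn mulrnDr.
have -> : G b - G a = (G b - G x) + (G x - G a) by ring.
by rewrite (le_trans (ler_normD _ _))//; lra.
Qed.

(* one step: divide by [X - a], on the right half of the interval *)
Lemma remez_itv k : exists2 C : R, 1 <= C & forall q (s l a b delta : R),
  (size q <= k.+1)%N -> s <= a -> a < b -> b <= s + l ->
  (forall t, a <= t <= b -> `|q.[t]| <= delta) ->
  forall t, s <= t <= s + l -> `|q.[t]| <= C * delta * (l / (b - a)) ^+ k.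
Proof.
elim: k => [|k [C C1 IH]].
  exists 1 => // q s l a b delta sq sa ab bl qd t _.
  have : `|q.[a]| <= delta by apply: qd; rewrite lexx ltW.
  by rewrite expr0 mulr1 mul1r (size1_polyC sq) !hornerC.
exists (1 + 4 * C * 2 ^+ k); first by rewrite lerDl !mulr_ge0//; lra.
move=> q s l a b delta sq sa ab bl qd t stl.
have delta0 : 0 <= delta.
  by rewrite (le_trans _ (qd a _))// lexx ltW.
have /factor_theorem[u uE] : root (q - q.[a]%:P) a.
  by rewrite rootE !hornerE subrr.
have qE x : q.[x] = q.[a] + u.[x] * (x - a).
  by have := congr1 (horner^~ x) uE; rewrite !hornerE; lra.
have su : (size u <= k.+1)%N.
  have [->|u0] := eqVneq u 0; first by rewrite size_poly0.
  have : (size (u * ('X - a%:P))%R <= k.+2)%N.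
    by rewrite -uE (leq_trans (size_polyD _ _))// geq_max sq size_polyN (leq_trans (size_polyC_leq1 _)).
  by rewrite size_Mmonic ?monicXsubC// size_XsubC addn2.
(* On the right half [x - a] is at least [(b - a) / 2], and [q.[x] - q.[a]] is at most [2 * delta];
   this bounds the quotient [u], of lower degree, on an interval of half the length. *)
pose c := (a + b) / 2.
have ba0 : 0 < b - a by rewrite subr_gt0.
have ud x : c <= x <= b -> `|u.[x]| <= 4 * delta / (b - a).
  move=> /andP[cx xb]; rewrite ler_pdivlMr//.
  have qa : `|q.[a]| <= delta by apply: qd; rewrite lexx ltW.
  have : `|q.[x]| <= delta.
    by apply: qd; rewrite xb andbT (le_trans _ cx)// /c; lra.
  rewrite (qE x) => qx.
  have : `|u.[x] * (x - a)| <= 2 * delta.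
    have -> : u.[x] * (x - a) = (q.[a] + u.[x] * (x - a)) - q.[a] by ring.
    by rewrite (le_trans (ler_normB _ _))//; lra.
  rewrite normrM (@ger0_norm _ (x - a)); last by move: cx; rewrite /c; lra.
  have : `|u.[x]| * ((b - a) / 2) <= `|u.[x]| * (x - a).
    by rewrite ler_wpM2l//; move: cx; rewrite /c; lra.
  by lra.
have sc : s <= c by rewrite /c; lra.
have cb : c < b by rewrite /c; lra.
have := IH u s l c b _ su sc cb bl ud t stl.
have -> : b - c = (b - a) / 2 by rewrite /c; field.
have -> : l / ((b - a) / 2) = 2 * (l / (b - a)) by field; rewrite gt_eqF.
rewrite exprMn => ut.
have lba : 1 <= l / (b - a) by rewrite ler_pdivlMr// mul1r; lra.
have l0 : 0 <= l by lra.
rewrite qE (le_trans (ler_normD _ _))// normrM.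
have ta : `|t - a| <= l by case/andP: stl => ? ?; rewrite ler_norml; lra.
have : `|u.[t]| * `|t - a| <=
    C * (4 * delta / (b - a)) * (2 ^+ k * (l / (b - a)) ^+ k) * l.
  by rewrite ler_pM.
have : `|q.[a]| <= delta by apply: qd; rewrite lexx ltW.
have : delta <= delta * (l / (b - a)) ^+ k.+1.
  by rewrite ler_peMr// exprn_ege1.
rewrite (exprS (l / (b - a))).
set P := (l / (b - a)) ^+ k => h1 h2 h3.
have -> : (1 + 4 * C * 2 ^+ k) * delta * (l / (b - a) * P) =
  delta * (l / (b - a) * P) + C * (4 * delta / (b - a)) * (2 ^+ k * P) * l.
  by field; rewrite gt_eqF.
by lra.
Qed.

(** The Remez inequality at the point where [q] reaches [M], solved for the length [b - a]. As
    [C >= 1], its root of order [k.+1] can be replaced by [C] itself. *)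
Lemma remez_itv_length k : exists2 C : R, 1 <= C & forall q (s l a b M u : R),
  (size q <= k.+2)%N -> s <= a -> a <= b -> b <= s + l -> 0 < M -> 0 < u ->
  (exists2 t, s <= t <= s + l & M <= `|q.[t]|) ->
  (forall t, a <= t <= b -> `|q.[t]| <= M * u ^+ k.+1) ->
  b - a <= C * (l * u).
Proof.
have [C C1 hC] := remez_itv k.+1.
exists C => // q s l a b M u sq sa + bl M0 u0 [t tl Mt] qle.
have C0 : 0 < C by apply: lt_le_trans C1.
have l0 : 0 <= l by case/andP: tl; lra.
have u_ge0 := ltW u0; have C_ge0 := ltW C0.
rewrite le_eqVlt => /predU1P[<-|ab]; first by rewrite subrr !mulr_ge0.
have := le_trans Mt (hC q s l a b _ sq sa ab bl qle t tl).
have ba0 : 0 < b - a by rewrite subr_gt0.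
have -> : C * (M * u ^+ k.+1) * (l / (b - a)) ^+ k.+1 =
    M * (C * (u * (l / (b - a))) ^+ k.+1) by rewrite (exprMn _ u); ring.
rewrite ler_pMr// => h.
rewrite leNgt; apply/negP => lt.
have : (C * (u * (l / (b - a)))) ^+ k.+1 < 1.
  apply: exprn_ilt1 => //.
    by rewrite !mulr_ge0// invr_ge0 ltW.
  have -> : C * (u * (l / (b - a))) = C * (l * u) / (b - a) by ring.
  by rewrite ltr_pdivrMr// mul1r.
rewrite ltNge exprMn => /negP; apply; apply: le_trans h _.
rewrite ler_wpM2r//; last by rewrite ler_eXnr.
by rewrite exprn_ge0// !mulr_ge0// invr_ge0 ltW.
Qed.

(** A factor that vanishes identically has constant sign, hence asks for no cut; replacing it by 1
    keeps the product of the factors nonzero. *)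
Definition nonzero_or1 r : {poly R} := if r == 0 then 1 else r.

Lemma nonzero_or1_neq0 r : nonzero_or1 r != 0.
Proof. by rewrite /nonzero_or1; case: ifPn => // _; rewrite oner_eq0. Qed.

Lemma size_nonzero_or1 r k : (size r <= k.+1)%N ->
  (size (nonzero_or1 r) <= k.+1)%N.
Proof. by rewrite /nonzero_or1; case: ifPn => // _; rewrite size_poly1. Qed.

Lemma horner_sign_itv_or1 r (a b : R) :
  (forall t, a < t < b -> ~~ root (nonzero_or1 r) t) ->
  (forall t, a <= t <= b -> 0 <= r.[t]) \/
  (forall t, a <= t <= b -> r.[t] <= 0).
Proof.
rewrite /nonzero_or1; case: eqVneq => [-> _|_]; last exact: horner_sign_itv.
by left => t _; rewrite horner0.
Qed.

(* The interval is cut at the roots of [(p' - delta) (p' + delta) p'']. *)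
Lemma normr_increment_le_split m p (phi dphi G H : R -> R)
    (eps delta e a b : R) : (size p <= m.+2)%N ->
  (forall u : R, is_derive u 1 phi (dphi u)) ->
  (forall u, `|phi u| <= eps) -> (forall u, `|dphi u| <= 1) -> 0 < delta ->
  (forall t : R, is_derive t 1 G (dphi p.[t])) -> 0 <= e -> a <= b ->
  {in `[a, b] &, {homo H : x y / x <= y}} ->
  (forall x y, a <= x -> x <= y -> y <= b ->
    (forall t, x <= t <= y -> `|p^`().[t]| <= delta) ->
    y - x <= e + (H y - H x)) ->
  `|G b - G a| <= (4 * (eps / delta) + e) *+ 2 ^ (3 * m.+1) + (H b - H a).
Proof.
move=> sp phiE phi_le dphi1 delta0 GE e0 ab Hmono small.
have eps0 : 0 <= eps by apply: le_trans (phi_le 0).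
have sq : (size p^`() <= m.+1)%N.
  have [->|p0] := eqVneq p 0; first by rewrite deriv0 size_poly0.
  by rewrite -ltnS (leq_trans (lt_size_deriv p0)).
have sq' : (size p^`()^`() <= m.+1)%N.
  have [->|q0] := eqVneq p^`() 0; first by rewrite deriv0 size_poly0.
  by rewrite (leq_trans (ltnW (lt_size_deriv q0))).
have sC (d : R) : (size (p^`() + d%:P)%R <= m.+1)%N.
  rewrite (leq_trans (size_polyD _ _))// geq_max sq.
  by rewrite (leq_trans (size_polyC_leq1 _)).
pose r := nonzero_or1 (p^`() + (- delta)%:P) *
  nonzero_or1 (p^`() + delta%:P) * nonzero_or1 p^`()^`().
have r0 : r != 0 by rewrite !mulf_neq0// nonzero_or1_neq0.
have sr : (size r <= (3 * m.+1).+1)%N.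
  rewrite (leq_trans (size_polyMleq _ _))//.
  have := size_polyMleq (nonzero_or1 (p^`() + (- delta)%:P))
    (nonzero_or1 (p^`() + delta%:P)).
  have := size_nonzero_or1 (sC (- delta)).
  have := size_nonzero_or1 (sC delta).
  have := size_nonzero_or1 sq'.
  move: (size _) (size _) (size _) (size _) => n1 n2 n3 n4; lia.
have c0 : 0 <= 4 * (eps / delta) + e.
  by rewrite addr_ge0// mulr_ge0// divr_ge0// ltW.
apply: (increment_split_roots sr r0 c0 ab) => x y ax xy yb nr.
have xyab t : x <= t <= y -> t \in `[a, b].
  move=> /andP[xt ty]; rewrite in_itv/=; apply/andP; split.
    exact: le_trans xt.
  exact: le_trans yb.
have H0 : 0 <= H y - H x.
  by rewrite subr_ge0 Hmono// xyab// lexx ?xy.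
have big : (forall t, x <= t <= y -> delta <= `|p^`().[t]|) ->
    `|G y - G x| <= 4 * (eps / delta) + e + (H y - H x).
  move=> qd; rewrite (@le_trans _ _ (4 * (eps / delta)))//; last by lra.
  apply: (normr_increment_le_monotone phiE phi_le delta0 GE xy qd).
  apply: horner_sign_itv_or1 => t txy; have := nr t txy.
  by rewrite /r !rootM !negb_or => /andP[].
(* Between two cuts [p' - delta] and [p' + delta] keep their signs, so either [|p'| >= delta]
   throughout, which is the monotone case, or [|p'| <= delta] throughout, and then the increment is
   at most the length, bounded by [small]. *)
have s1 := @horner_sign_itv_or1 (p^`() + (- delta)%:P) x y.
have s2 := @horner_sign_itv_or1 (p^`() + delta%:P) x y.
have {s1}[t txy||] := s1.
- by have := nr t txy; rewrite /r !rootM !negb_or -andbA => /andP[].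
- move=> s1; apply: big => t txy; rewrite (le_trans _ (ler_norm _))//.
  by have := s1 t txy; rewrite !hornerE; lra.
have {s2}[t txy||] := s2.
- by have := nr t txy; rewrite /r !rootM !negb_or -andbA => /and3P[].
- move=> s2 s1; rewrite (le_trans (normr_increment_le xy GE (fun=> dphi1 _)))//.
  rewrite (le_trans (small x y ax xy yb _))//; last first.
    by rewrite -addrA lerDr mulr_ge0// divr_ge0// ltW.
  move=> t txy; have := s1 t txy; have := s2 t txy; rewrite !hornerE => ? ?.
  by rewrite ler_norml; lra.
- move=> s2 _; apply: big => t txy; rewrite -normrN (le_trans _ (ler_norm _))//.
  by have := s2 t txy; rewrite !hornerE; lra.
Qed.

End one_variable_polynomials.

(** * Estimates of van der Corput type *)

Section van_der_corput.
Context {R : realType}.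
Implicit Types (G H phi dphi : R -> R) (p q r : {poly R}).

(** The intervals where [|p'| <= delta] are charged to [H]: since [g] dominates the indicator of
    [[- delta, delta]], the increment of [H] there is at least the length. *)
Lemma normr_increment_le_sublevel m p phi dphi (g : R -> R) G H
    (eps delta a b : R) : (size p <= m.+2)%N ->
  (forall u : R, is_derive u 1 phi (dphi u)) ->
  (forall u, `|phi u| <= eps) -> (forall u, `|dphi u| <= 1) -> 0 < delta ->
  (forall t : R, is_derive t 1 G (dphi p.[t])) ->
  (forall t : R, is_derive t 1 H (g p^`().[t])) ->
  (forall u, 0 <= g u) -> (forall u, `|u| <= delta -> 1 <= g u) -> a <= b ->
  `|G b - G a| <= (4 * (eps / delta)) *+ 2 ^ (3 * m.+1) + (H b - H a).
Proof.
move=> sp phiE phi_le dphi1 delta0 GE HE g0 g1 ab.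
rewrite -[X in X *+ _]addr0.
apply: (normr_increment_le_split sp phiE phi_le dphi1 delta0 GE _ ab) => //.
  move=> x y _ _ xy; rewrite -subr_ge0.
  have := @le_increment _ (cst 0) H (cst 0) (g \o horner p^`()) x y xy.
  rewrite /= subrr; apply => // t _; exact: g0.
move=> x y ax xy yb qd; rewrite add0r.
apply: (@le_increment _ id H (cst 1) (g \o horner p^`())) => // t /andP[xt ty].
by apply: g1; apply: qd; rewrite !ltW.
Qed.

(** The threshold [delta = M u ^ m] balances the two errors: integration by parts costs
    [eps / delta <= l u], and Remez bounds the intervals where [|p'| <= delta] by a multiple of
    [l u]. For [m = 0] the derivative is constant, at least [M] in absolute value, and no interval
    is lost. *)
Lemma normr_increment_le_root m : exists2 C : R, 1 <= C &
  forall p phi dphi G (eps s l a b M u : R), (size p <= m.+2)%N ->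
  (forall u : R, is_derive u 1 phi (dphi u)) ->
  (forall u, `|phi u| <= eps) -> (forall u, `|dphi u| <= 1) ->
  (forall t : R, is_derive t 1 G (dphi p.[t])) ->
  s <= a -> a <= b -> b <= s + l -> 0 < M -> 0 < u ->
  eps <= u ^+ m.+1 * (l * M) ->
  (exists2 t, s <= t <= s + l & M <= `|p^`().[t]|) ->
  `|G b - G a| <= C * (l * u).
Proof.
case: m => [|m].
  exists 4; first by lra.
  move=> p phi dphi G eps s l a b M u sp phiE phi_le dphi1 GE sa ab bl M0 u0
    epsle [t tl Mt].
  have sq : (size p^`() <= 1)%N.
    have [->|p0] := eqVneq p 0; first by rewrite deriv0 size_poly0.
    by rewrite -ltnS (leq_trans (lt_size_deriv p0)).
  have qM x : M <= `|p^`().[x]|.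
    by move: Mt; rewrite (size1_polyC sq) !hornerC.
  apply: (le_trans (normr_increment_le_monotone phiE phi_le M0 GE ab _ _)).
  - by move=> x _; exact: qM.
  - by left => x _; rewrite (size1_polyC sq) derivC horner0.
  - rewrite ler_pM2l// ler_pdivrMr//; move: epsle; rewrite expr1; lra.
have [C C1 hC] := @remez_itv_length R m.
exists ((4 + C) *+ 2 ^ (3 * m.+2)).
  rewrite (@le_trans _ _ (4 + C))//; first lra.
  rewrite -{1}(mulr1n (4 + C)) ler_wpMn2l ?expn_gt0//; lra.
move=> p phi dphi G eps s l a b M u sp phiE phi_le dphi1 GE sa ab bl M0 u0
  epsle [t tl Mt].
have l0 : 0 <= l by case/andP: tl; lra.
have delta0 : 0 < M * u ^+ m.+1 by rewrite mulr_gt0// exprn_gt0.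
have sq : (size p^`() <= m.+2)%N.
  have [->|p0] := eqVneq p 0; first by rewrite deriv0 size_poly0.
  by rewrite -ltnS (leq_trans (lt_size_deriv p0)).
have e0 : 0 <= C * (l * u) by rewrite !mulr_ge0 ?(ltW u0)//; lra.
apply: (le_trans (@normr_increment_le_split _ m.+1 p phi dphi G (cst 0) eps
  (M * u ^+ m.+1) (C * (l * u)) a b sp phiE phi_le dphi1 delta0 GE e0 ab _ _)).
- by move=> x y _ _ xy.
- move=> x y ax xy yb qd; rewrite /= subrr addr0.
  apply: (hC p^`() s l x y M u) => //; [exact: le_trans ax|exact: le_trans bl|].
  by exists t.
rewrite /= subrr addr0 (_ : (4 + C) *+ _ * _ =
  ((4 + C) * (l * u)) *+ 2 ^ (3 * m.+2)); last by rewrite -mulrnAl.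
rewrite lerMn2r; apply/orP; right; rewrite (mulrDl 4 C) lerD2r ler_pM2l// ler_pdivrMr//.
by apply: le_trans epsle _; rewrite le_eqVlt; apply/predU1P; left; rewrite exprS; ring.
Qed.

End van_der_corput.

(** * Primitives on the whole line *)

Section primitive.
Context {R : realType}.
Notation mu := (@lebesgue_measure R).
Variable F : R -> R.
Hypothesis cF : continuous F.

Let P (a x : R) : R := (\int[mu]_(t in `[a, x]) F t)%R.

Let is_derive_P (a x : R) : a < x -> is_derive x 1 (P a) (F x).
Proof.
move=> ax.
have intF : mu.-integrable `[a, x + 1] (EFin \o F).
  apply: continuous_compact_integrable; first exact: segment_compact.
  exact: continuous_subspaceT.
have xx1 : x < x + 1 by rewrite ltrDl.
have [dP PE] := continuous_FTC1_closed xx1 intF ax (@cF x).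
by apply: DeriveDef; [exact: dP|rewrite -derive1E; exact: PE].
Qed.

Let P_indep (a b x y : R) : a < x -> b < x -> x <= y ->
  P a y - P a x = P b y - P b x.
Proof.
move=> ax bx xy; apply/le_anti/andP; split;
  apply: (le_increment xy (dF := F) (dG := F)) => // z /andP[xz _];
  by apply: is_derive_P; apply: lt_le_trans xz.
Qed.

(** The integral from [a] is differentiated only to the right of [a], so the base point moves with
    [x]. Subtracting the value at 0 makes the result independent of the base point, hence locally
    equal to a primitive with fixed base. *)
Lemma continuous_primitive :
  exists G : R -> R, forall x : R, is_derive x 1 G (F x).
Proof.
pose G x := P (- (`|x| + 1)) x - P (- (`|x| + 1)) 0.
have GE a x : a < 0 -> a < x -> G x = P a x - P a 0.
  move=> a0 ax; rewrite /G.
  have b0 : - (`|x| + 1) < 0 by rewrite oppr_lt0 ltr_pwDr.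
  have bx : - (`|x| + 1) < x.
    by rewrite ltrNl (le_lt_trans (ler_norm _))// normrN ltrDl.
  have [x0|/ltW x0] := leP 0 x; first exact: P_indep.
  by apply: oppr_inj; rewrite !opprB; exact: P_indep.
exists G => x.
pose a := - (`|x| + 2).
have dP : is_derive x 1 (P a - cst (P a 0)) (F x - 0).
  have ax : a < x.
    by rewrite /a ltrNl (le_lt_trans (ler_norm _))// normrN ltrDl.
  have := is_derive_P ax => ?; exact: is_deriveB.
rewrite subr0 in dP.
apply: near_eq_is_derive dP.
near=> y.
rewrite !fctE /= (GE a)//; first by rewrite /a oppr_lt0 ltr_pwDr.
rewrite /a ltrNl; have : `|x - y| < 1 by near: y; apply/nbhs_ballP; exists 1 => //=.
rewrite ltr_norml => /andP[h1 h2].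
by have := ler_norm (- x); rewrite normrN; lra.
Unshelve. all: by end_near. Qed.

End primitive.

(** * Product measures *)

Section bounded_functions.
Context {R : realType}.

Lemma bounded_integrable {d} {T : measurableType d}
    (P : {finite_measure set T -> \bar R}) (D : set T) (h : T -> R) (M : R) :
  measurable D -> measurable_fun D h -> (forall x, `|h x| <= M) ->
  P.-integrable D (EFin \o h).
Proof.
move=> mD mh hM; apply: measurable_bounded_integrable => //.
  by rewrite ltey_eq fin_num_measure.
exists M; split; first exact: num_real.
by move=> y My x _; exact: le_trans (hM x) (ltW My).
Qed.

Lemma normr_Rintegral_le {d} {T : measurableType d} (P : probability T R)
    (h : T -> R) (M : R) : measurable_fun setT h -> (forall x, `|h x| <= M) ->
  `|\int[P]_x h x| <= M.
Proof.
move=> mh hM.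
have ih : P.-integrable setT (EFin \o h) by exact: bounded_integrable hM.
rewrite (le_trans (le_normr_Rintegral measurableT ih))//.
rewrite (@le_trans _ _ (\int[P]_x M))//.
  apply: le_Rintegral => //.
    apply: (@bounded_integrable _ _ _ _ (fun x => `|h x|) M) => //.
      exact: measurableT_comp.
    by move=> x; rewrite normr_id.
  by apply: (@bounded_integrable _ _ _ _ (cst M) `|M|).
rewrite Rintegral_cst//.
by have /(congr1 fine) /= -> := probability_setT P; rewrite mulr1.
Qed.

Lemma Rintegral_sum {d} {T : measurableType d} (Q : {measure set T -> \bar R})
    (N : nat) (F : nat -> T -> R) :
  (forall j, Q.-integrable setT (EFin \o F j)) ->
  \int[Q]_x (\sum_(j < N) F j x) = \sum_(j < N) \int[Q]_x F j x.
Proof.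
move=> iF.
suff [] : Q.-integrable setT (EFin \o (fun x => \sum_(j < N) F j x)) /\
    \int[Q]_x (\sum_(j < N) F j x) = \sum_(j < N) \int[Q]_x F j x by [].
elim: N => [|N [iN IN]].
  rewrite big_ord0; under [X in EFin \o X]eq_fun do rewrite big_ord0.
  under eq_Rintegral do rewrite big_ord0.
  by rewrite Rintegral_cst// mul0r; split => //; exact: integrable0.
rewrite big_ord_recr/=; under [X in EFin \o X]eq_fun do rewrite big_ord_recr.
under eq_Rintegral do rewrite big_ord_recr/=.
rewrite RintegralD// IN; split => //.
exact: (integrableD measurableT iN (iF N)).
Qed.

Context {d1 d2} {T1 : measurableType d1} {T2 : measurableType d2}.
Variables (P : probability T1 R) (Q : probability T2 R).
Variables (h : T1 * T2 -> R) (M : R).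
Hypotheses (mh : measurable_fun setT h) (hM : forall x, `|h x| <= M).

Let ih : (P \x Q)%E.-integrable setT (EFin \o h).
Proof. exact: (@bounded_integrable _ _ (prod2 P Q) _ _ M). Qed.

Let mh1 x : measurable_fun setT (fun y => h (x, y)).
Proof. by apply: measurableT_comp => //; exact: measurable_pair1. Qed.

Let mh2 y : measurable_fun setT (fun x => h (x, y)).
Proof. by apply: measurableT_comp => //; exact: measurable_pair2. Qed.

Let RintegralE1 x : (\int[Q]_y h (x, y))%:E = (\int[Q]_y (h (x, y))%:E)%E.
Proof.
rewrite /Rintegral fineK//; apply: integrable_fin_num => //.
exact: (@bounded_integrable _ _ _ _ (fun y => h (x, y)) M).
Qed.

Let RintegralE2 y : (\int[P]_x h (x, y))%:E = (\int[P]_x (h (x, y))%:E)%E.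
Proof.
rewrite /Rintegral fineK//; apply: integrable_fin_num => //.
exact: (@bounded_integrable _ _ _ _ (fun x => h (x, y)) M).
Qed.

Lemma measurable_Rintegral2 : measurable_fun setT (fun y => \int[P]_x h (x, y)).
Proof.
apply/measurable_EFinP; rewrite [X in measurable_fun _ X](_ : _ =
  (fun y => \int[P]_x (h (x, y))%:E)%E); first exact: measurable_fubini_G ih.
by apply/funext => x; exact: RintegralE2.
Qed.

Lemma Rintegral_prod1 :
  \int[(P \x Q)%E]_z h z = \int[P]_x \int[Q]_y h (x, y).
Proof.
rewrite /Rintegral -(integral12_prod_meas1 ih); congr fine.
by apply: eq_integral => x _; exact/esym/RintegralE1.
Qed.

Lemma Rintegral_Fubini :
  \int[P]_x \int[Q]_y h (x, y) = \int[Q]_y \int[P]_x h (x, y).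
Proof.
rewrite -Rintegral_prod1 /Rintegral -(integral21_prod_meas1 ih); congr fine.
by apply: eq_integral => x _; exact/esym/RintegralE2.
Qed.

End bounded_functions.

(** * Replacing one coordinate under a product measure *)

Section coordinates.
Context {d} {T : measurableType d} {R : realType} {n : nat}.
Implicit Types (x : n.-tuple T) (i : 'I_n) (t : T).

Definition upd x i t : n.-tuple T :=
  [tuple if j == i then t else tnth x j | j < n].

Lemma tnth_upd x i t j : tnth (upd x i t) j = if j == i then t else tnth x j.
Proof. by rewrite tnth_mktuple. Qed.

Definition updP (P : 'I_n -> probability T R) i (Q : probability T R) :
  'I_n -> probability T R := fun j => if j == i then Q else P j.

Lemma updP_id P i : updP P i (P i) = P.
Proof. by apply/funext => j; rewrite /updP; case: eqVneq => [->|]. Qed.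

Definition upd_pair i (z : T * n.-tuple T) : n.-tuple T := upd z.2 i z.1.

Lemma measurable_upd_pair i : measurable_fun [set: T * n.-tuple T] (upd_pair i).
Proof.
apply/measurable_fun_tnthP => j; rewrite /comp.
under eq_fun do rewrite /upd_pair tnth_upd.
case: eqVneq => _; first exact: measurable_fst.
exact: (measurableT_comp (measurable_tnth j) measurable_snd).
Qed.

HB.instance Definition _ i :=
  isMeasurableFun.Build _ _ _ _ (upd_pair i) (measurable_upd_pair i).

Definition box (A : 'I_n -> set T) : set (n.-tuple T) :=
  [set x | forall i, A i (tnth x i)].

Lemma measurable_box A : (forall i, measurable (A i)) -> measurable (box A).
Proof.
move=> mA; rewrite /box [X in measurable X](_ : _ =
    \bigcap_(i in [set: 'I_n]) (@tnth n T ^~ i) @^-1` A i).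
  apply: fin_bigcap_measurable => // i _.
  by rewrite -[X in measurable X]setTI; exact: measurable_tnth.
by apply/seteqP; split => [x /= h i _|x h i]; exact: h.
Qed.

(** Boxes are stable under intersection, and they generate the sigma-algebra because the preimage of
    a set under one coordinate is a box with all other sides full. *)
Lemma eq_measure_box (m1 m2 : {measure set (n.-tuple T) -> \bar R}) :
  (m1 setT < +oo)%E ->
  (forall A, (forall i, measurable (A i)) -> m1 (box A) = m2 (box A)) ->
  forall B, measurable B -> m1 B = m2 B.
Proof.
move=> m1oo m12.
pose G := [set B | exists2 A, (forall i, measurable (A i)) & B = box A].
have GT : G setT.
  by exists (fun=> setT) => //; apply/seteqP; split.
have uniq : forall B, <<s G >> B -> m1 B = m2 B.
  apply: (@g_sigma_algebra_measure_unique _ _ _ G _ (fun=> setT)) => //.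
  - by move=> _ [A mA ->]; exact: measurable_box.
  - by apply/seteqP; split => // x _; exists 0%N.
  - move=> _ _ [A mA ->] [A' mA' ->]; exists (fun i => A i `&` A' i).
      by move=> i; exact: measurableI.
    apply/seteqP; split => [x [h h'] i|x h]; first by split.
    by split => i; have [] := h i.
  - by move=> _ [A mA ->]; exact: m12.
move=> B mB; apply: uniq; apply: (smallest_sub _ _ mB).
  exact: smallest_sigma_algebra.
move=> C /=; rewrite -bigcup_seq => -[i _] [A mA <-].
apply: sub_sigma_algebra; exists (fun j => if j == i then A else setT).
  by move=> j; case: ifP.
apply/seteqP; split => [x [_ /= Ax] j|x h]; first by case: eqVneq => [->|].
by split => //=; have := h i; rewrite eqxx.
Qed.

(** The law [updP P i Q] is the image of the product of [Q] and [product_probability P] when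
    coordinate [i] is overwritten: on boxes, the overwritten factor contributes [P i setT = 1]. The
    case [Q = P i] isolates one coordinate of the original law. *)
Lemma Rintegral_updP (P : 'I_n -> probability T R) i (Q : probability T R)
    (h : n.-tuple T -> R) (M : R) :
  measurable_fun setT h -> (forall x, `|h x| <= M) ->
  \int[product_probability (updP P i Q)]_x h x =
  \int[Q]_t \int[product_probability P]_x h (upd x i t).
Proof.
move=> mh hM.
have mhg : measurable_fun setT (h \o upd_pair i) by exact: measurableT_comp.
have := @Rintegral_prod1 _ _ _ _ _ Q (product_probability P) _ M mhg.
rewrite {1}/comp => <- //.
pose m2 := distribution (prod2 Q (product_probability P)) (upd_pair i).
have e B : measurable B -> product_probability (updP P i Q) B = m2 B.
  move: B; apply: eq_measure_box.
    by rewrite (@le_lt_trans _ _ 1%E) ?ltry//; exact: probability_le1.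
  move=> A mA; transitivity (\prod_(j < n) updP P i Q j (A j))%E.
    exact: product_probability_box.
  transitivity (prod2 Q (product_probability P)
      (A i `*` box (fun j => if j == i then setT else A j))); last first.
    rewrite /m2 /distribution /pushforward; congr (_ _).
    apply/seteqP; split => -[t x] /=.
      move=> [Ait h'] j; rewrite /upd_pair tnth_upd /=.
      by have := h' j; case: eqVneq => [->|].
    move=> h'; split; first by have := h' i; rewrite /upd_pair tnth_upd eqxx.
    by move=> j; have := h' j; rewrite /upd_pair tnth_upd; case: eqVneq.
  have mA' j : measurable (if j == i then setT else A j) by case: ifP.
  transitivity (Q (A i) * product_probability P
      (box (fun j => if j == i then setT else A j)))%E; last first.
    by apply/esym; apply: product_measure1E => //; exact: measurable_box.
  transitivity (Q (A i) *
      \prod_(j < n) P j (if j == i then setT else A j))%E; last first.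
    by congr (_ * _)%E; apply/esym; exact: product_probability_box.
  rewrite (bigD1 i)//= [in RHS](bigD1 i)//= eqxx.
  rewrite probability_setT mul1e {1}/updP eqxx; congr (_ * _)%E.
  by apply: eq_bigr => j /negbTE ji; rewrite /updP ji.
rewrite /Rintegral (eq_measure_integral m2); last first.
  by move=> B mB _; exact: e.
congr fine; rewrite integral_distribution//.
  exact/measurable_EFinP.
exact: (@bounded_integrable _ _ _ (prod2 Q (product_probability P)) _ _ M).
Qed.

End coordinates.

(** * Laws with a density of bounded variation *)

Section densities.
Context {R : realType}.
Notation mu := (@lebesgue_measure R).
Implicit Types (nu : probability (measurableTypeR R) R) (rho F G : R -> R).

(** The density agrees almost everywhere with the Radon-Nikodym derivative, having the same
    integrals on all measurable sets. *)
Lemma Rintegral_density nu rho F (M : R) : has_density nu rho ->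
  measurable_fun setT F -> (forall x, `|F x| <= M) ->
  \int[nu]_x F x = \int[mu]_x (F x * rho x).
Proof.
move=> [irho nuE] mF FM.
have dom : nu `<< mu.
  apply/null_content_dominatesP => A mA A0.
  rewrite nuE// null_set_integral//.
  by apply: measurable_funTS; exact: (measurable_int mu irho).
have iF : nu.-integrable setT (EFin \o F) by exact: (bounded_integrable nu measurableT mF FM).
rewrite /Rintegral -(Radon_Nikodym_change_of_variables dom measurableT iF).
congr fine.
apply: ae_eq_integral => //.
- apply: emeasurable_funM; first exact/measurable_EFinP.
  by apply: measurable_int; exact: Radon_Nikodym_integrable.
- under eq_fun do rewrite EFinM.
  by apply: emeasurable_funM; [exact/measurable_EFinP|exact: measurable_int irho].
under [X in ae_eq _ _ _ X]eq_fun do rewrite EFinM.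
apply: ae_eqe_mul2l; apply: integral_ae_eq => //.
- exact: Radon_Nikodym_integrable.
- exact: measurable_int irho.
- by move=> E _ mE; rewrite -Radon_Nikodym_integral//; exact: nuE.
Qed.

Lemma uniform_density (a b : R) (ab : a < b) :
  has_density (uniform_prob ab) (uniform_pdf a b).
Proof. by split => //; exact: integrable_uniform_pdf. Qed.

Lemma Rintegral_uniform (a b : R) (ab : a < b) F G (M : R) : continuous F ->
  (forall x, `|F x| <= M) -> (forall x : R, is_derive x 1 G (F x)) ->
  \int[uniform_prob ab]_x F x = (G b - G a) / (b - a).
Proof.
move=> cF FM GE.
have mF : measurable_fun setT F by exact: continuous_measurable_fun.
rewrite (Rintegral_density (uniform_density ab) mF FM).
rewrite [LHS](_ : _ = \int[mu]_(x in `[a, b]) ((b - a)^-1 * F x)); last first.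
  rewrite [RHS]Rintegral_mkcond; apply: eq_Rintegral => x _.
  rewrite patchE /uniform_pdf mem_setE in_itv/=.
  by case: ifP; rewrite ?mulr0// mulrC.
have iF : mu.-integrable `[a, b] (EFin \o F).
  apply: continuous_compact_integrable; first exact: segment_compact.
  exact: continuous_subspaceT.
rewrite RintegralZl// mulrC /Rintegral (@continuous_FTC2 _ F G)//.
- exact: continuous_subspaceT.
- split => [x _||]; first by have [] := GE x.
  + by apply: cvg_at_right_filter; exact: is_derive_continuous (GE a).
  + by apply: cvg_at_left_filter; exact: is_derive_continuous (GE b).
- by move=> x _; rewrite derive1E; have [_ ->] := GE x.
Qed.

Definition addr_fun (c : R) (x : measurableTypeR R) : measurableTypeR R := x + c.

Lemma measurable_addr_fun c : measurable_fun setT (addr_fun c).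
Proof. exact: measurable_funD. Qed.

HB.instance Definition _ c :=
  isMeasurableFun.Build _ _ _ _ (addr_fun c) (measurable_addr_fun c).

(** Translation preserves the length of half-open intervals, which determine Lebesgue measure. *)
Lemma lebesgue_measure_shift (c : R) (A : set (measurableTypeR R)) :
  measurable A -> mu A = pushforward mu (addr_fun c) A.
Proof.
move=> mA; apply: lebesgue_measure_unique => //= _ [[a b]] _ <-.
rewrite /pushforward (_ : addr_fun c @^-1` _ = `]a - c, b - c]%classic).
  rewrite !lebesgue_measure_itv/= !lte_fin ltrD2r -!EFinB.
  by rewrite opprB addrA subrK.
by apply/seteqP; split => x; rewrite /= !in_itv/= /addr_fun ltrBlDr lerBrDr.
Qed.

Lemma ge0_integral_shift (c : R) (f : measurableTypeR R -> \bar R) :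
  measurable_fun setT f -> (forall x, 0 <= f x)%E ->
  (\int[mu]_x f (x + c)%R = \int[mu]_x f x)%E.
Proof.
move=> mf f0; rewrite [RHS](eq_measure_integral (pushforward mu (addr_fun c))).
  by rewrite ge0_integral_pushforward.
by move=> A mA _; exact: lebesgue_measure_shift.
Qed.

Lemma integrable_shift (c : R) (f : measurableTypeR R -> R) :
  mu.-integrable setT (EFin \o f) ->
  mu.-integrable setT (EFin \o (fun x => f (x + c))).
Proof.
move=> /integrableP[mf foo]; apply/integrableP; split.
  exact: (measurableT_comp mf (measurable_addr_fun c)).
rewrite (@ge0_integral_shift c (fun x => `|(f x)%:E|%E))//.
exact: measurableT_comp.
Qed.

Lemma Rintegral_shift (c : R) (f : measurableTypeR R -> R) :
  mu.-integrable setT (EFin \o f) ->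
  \int[mu]_x f (x + c) = \int[mu]_x f x.
Proof.
move=> fi; rewrite /Rintegral; congr fine.
rewrite [RHS](eq_measure_integral (pushforward mu (addr_fun c))).
  rewrite integral_pushforward//; first exact: measurable_int fi.
  exact: integrable_shift.
by move=> A mA _; exact: lebesgue_measure_shift.
Qed.

End densities.

(** * Laws of bounded variation as mixtures of uniform laws *)

Section spread.
Context {R : realType}.
Notation mu := (@lebesgue_measure R).

(* At scale [l], [nu] integrates a test function [F] as if it were a mixture of
   uniform laws on intervals of length at most [l]; [G] is a primitive of [F]. *)
Definition spread (l : R) (nu : probability (measurableTypeR R) R) : Prop :=
  forall (F G : R -> R) (k : R), continuous F -> (forall x, `|F x| <= 1) ->
  (forall x : R, is_derive x 1 G (F x)) ->
  (forall s b, s <= b -> b <= s + l -> `|G b - G s| <= l * k) ->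
  `|\int[nu]_x F x| <= 2 * k.

Lemma spread_uniform (l s : R) (sl : s < s + l) : spread l (uniform_prob sl).
Proof.
move=> F G k cF F1 GE Gk.
have l0 : 0 < l by rewrite -(ltrDl s).
have Gsl : `|G (s + l) - G s| <= l * k by apply: Gk => //; exact: ltW.
rewrite (Rintegral_uniform sl cF F1 GE) addrAC subrr add0r normrM.
rewrite (gtr0_norm (x := l^-1)) ?invr_gt0// ler_pdivrMr//.
have : 0 <= l * k by rewrite (le_trans _ Gsl).
by lra.
Qed.

(** Let [A] be the moving average of [F] over [[x, x + l]], bounded by [k]. Then [A - F] is the
    derivative of [K], the moving average of [G] minus [G], and [|K| <= l k]. Integrating [K']
    against [rho] by parts costs at most [l k B <= k], whence the factor 2. *)
Lemma spread_BV (l B : R) (nu : probability (measurableTypeR R) R)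
    (rho : R -> R) : 0 < l -> l * B <= 1 -> has_density nu rho ->
  is_BV rho -> fine (BV_norm rho) <= B -> spread l nu.
Proof.
move=> l0 lB dens bv bvB F G k cF F1 GE Gk.
have [irho _] := dens.
have k0 : 0 <= k.
  by have := Gk 0 0 (lexx 0); rewrite add0r subrr normr0 ltW// pmulr_rge0// => ->.
have cG : continuous G by move=> x; exact: is_derive_continuous (GE x).
have [GG GGE] := continuous_primitive cG.
pose A x := (G (x + l) - G x) / l.
pose K x := (GG (x + l) - GG x) / l - G x.
have xxl x : x <= x + l by rewrite lerDl ltW.
have A1 x : `|A x| <= 1.
  rewrite /A normrM (gtr0_norm (x := l^-1)) ?invr_gt0// ler_pdivrMr// mul1r.
  by have := normr_increment_le (xxl x) GE F1; rewrite addrAC subrr add0r.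
have Ak x : `|A x| <= k.
  rewrite /A normrM (gtr0_norm (x := l^-1)) ?invr_gt0// ler_pdivrMr// mulrC.
  exact: Gk.
(* By the mean value theorem the moving average of [G] is a value [G c] with [c] in [[x, x + l]]. *)
have Kk x : `|K x| <= l * k.
  have [|c] := @MVT_segment R GG G x (x + l) (xxl x).
    by apply: derivable_within_continuous => y _; have [] := GGE y.
  rewrite in_itv/= => /andP[xc cxl]; rewrite addrAC subrr add0r => E.
  by rewrite /K E mulfK ?gt_eqF//; exact: Gk.
have shiftE (H dH : R -> R) (x : R) : (forall y : R, is_derive y 1 H (dH y)) ->
    is_derive x 1 (fun y => H (y + l)) (dH (x + l)).
  move=> HE; have h : is_derive x 1 (fun y : R => y + l) (1 + 0) by exact: is_deriveD.
  have := @is_derive1_comp R H (fun y => y + l) x _ _ (HE (x + l)) h.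
  by rewrite addr0 mulr1.
have KE (x : R) : is_derive x 1 K (A x - F x).
  have h1 := shiftE _ _ x GGE.
  have h2 := is_deriveB h1 (GGE x).
  have h3 := is_deriveM h2 (is_derive_cst l^-1 x (1 : R)).
  have h4 := is_deriveB h3 (GE x).
  apply: (is_derive_eq h4).
  by rewrite /A scaler0 add0r /GRing.scale /= mulrC.
have cK : continuous K by move=> x; exact: is_derive_continuous (KE x).
have mK := continuous_measurable_fun cK.
have cA : continuous A.
  move=> x; apply: cvgM; last exact: cvg_cst.
  apply: cvgB; last exact: cG.
  apply: is_derive_continuous; exact: shiftE GE.
have mA := continuous_measurable_fun cA.
have mF := continuous_measurable_fun cF.
have K2 x y : x <= y -> `|K y - K x| <= 2 * (y - x).
  move=> xy; have [|c _ ->] := @MVT_segment R K _ x y xy.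
    by apply: derivable_within_continuous => z _; have [] := KE z.
  rewrite normrM (@ger0_norm _ (y - x)) ?subr_ge0// ler_wpM2r ?subr_ge0//.
  by rewrite (le_trans (ler_normB _ _))// -[2]/(1 + 1) lerD.
have imul rho' (irho' : mu.-integrable setT (EFin \o rho')) (H : R -> R) M :
    measurable_fun setT H -> (forall x, `|H x| <= M) ->
    mu.-integrable setT (EFin \o (fun x => H x * rho' x)).
  move=> mH HM.
  rewrite (_ : _ \o _ = (EFin \o H) \* (EFin \o rho'))%E; last first.
    by apply/funext => x /=; rewrite EFinM.
  apply: integrableMr => //; exists M; split; first exact: num_real.
  by move=> y My x _; exact: le_trans (HM x) (ltW My).
have BVle (h : R) : 0 < h -> \int[mu]_x `|rho (x - h) - rho x| <= h * B.
  move=> h0.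
  set I := (\int[mu]_x `|rho (x - h) - rho x|%:E)%E.
  have I0 : (0 <= I)%E by apply: integral_ge0.
  have Ile : (h^-1%:E * I <= BV_norm rho)%E.
    apply: le_trans (ereal_sup_ubound _); last by exists h.
    rewrite lee_pmul2l// ?lte_fin ?invr_gt0//.
    apply: ereal_sup_ubound; exists (- h) => //=.
    by rewrite normrN gtr0_norm.
  (* Finiteness is needed for [fine] to return the actual value and not its default 0. *)
  have bvfin : BV_norm rho \is a fin_num.
    rewrite ge0_fin_numE//; apply: le_trans Ile.
    by rewrite mule_ge0// lee_fin invr_ge0 ltW.
  have {}Ile : (I <= (h * B)%:E)%E.
    rewrite EFinM -lee_pdivrMl//; apply: (le_trans Ile).
    by rewrite -(fineK bvfin) lee_fin.
  rewrite -lee_fin /Rintegral -/I fineK// ge0_fin_numE//.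
  by rewrite (le_lt_trans Ile)// ltry.
(* As [rho] need not be differentiable, the integration by parts is done on difference quotients of
   [K]; [K] being 2-Lipschitz, they are dominated and converge to [A - F]. *)
pose hn n : R := n.+1%:R^-1.
have hn0 n : 0 < hn n by rewrite invr_gt0.
pose D n x := (K (x + hn n) - K x) / hn n.
have mKs n : measurable_fun setT (fun x : R => K (x + hn n)).
  by apply: (measurableT_comp mK); exact: measurable_funD.
have mD n : measurable_fun setT (D n).
  by apply: measurable_funM => //; exact: measurable_funB.
have D2 n x : `|D n x| <= 2.
  rewrite /D normrM (gtr0_norm (x := (hn n)^-1)) ?invr_gt0// ler_pdivrMr//.
  have xh : x <= x + hn n by rewrite lerDl ltW.
  by rewrite (le_trans (K2 _ _ xh))//; lra.
have Dcvg x : D n x @[n --> \oo] --> A x - F x.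
  have [dK KdE] := KE x.
  have : h^-1 *: ((K \o shift x) (h *: 1) - K x) @[h --> 0^'] --> A x - F x.
    by rewrite -KdE; exact: dK.
  move=> /cvg_dnbhs_at_right /cvg_at_rightP /(_ hn) h.
  have /h : (forall n, hn n > 0) /\ (hn n @[n --> \oo] --> (0 : R)).
    by split => //; exact: cvg_harmonic.
  apply: cvg_trans; apply: near_eq_cvg; near=> n.
  by rewrite /D /= /shift /= /GRing.scale /= mulr1 (addrC x) mulrC.
have Dint n : `|\int[mu]_x (D n x * rho x)| <= l * k * B.
  have irhos : mu.-integrable setT (EFin \o (fun x : R => rho (x - hn n))).
    exact: integrable_shift irho.
  have i1 := imul _ irho K (l * k) mK Kk.
  have i2 := imul _ irhos K (l * k) mK Kk.
  have i3 := imul _ irho (fun x : R => K (x + hn n)) (l * k) (mKs n) (fun=> Kk _).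
  have iB : mu.-integrable setT (EFin \o (fun x : R => rho (x - hn n) - rho x)).
    exact: (integrableB measurableT irhos irho).
  (* Translation invariance moves the difference from [K] to [rho]. *)
  have -> : \int[mu]_x (D n x * rho x) =
      (hn n)^-1 * \int[mu]_x (K x * (rho (x - hn n) - rho x)).
    rewrite (_ : (fun x => K x * (rho (x - hn n) - rho x)) =
      (fun x => K x * rho (x - hn n) - K x * rho x)); last first.
      by apply/funext => x; rewrite mulrBr.
    rewrite RintegralB// -(Rintegral_shift (hn n) i2).
    under [X in X - _]eq_Rintegral do rewrite addrK.
    rewrite -RintegralB// -RintegralZl//; last exact: (integrableB measurableT i3 i1).
    by apply: eq_Rintegral => x _; rewrite /D; ring.
  have iKB := imul _ iB K (l * k) mK Kk.
  rewrite normrM gtr0_norm ?invr_gt0// ler_pdivrMl//.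
  rewrite (le_trans (le_normr_Rintegral measurableT iKB))//.
  have iaB : mu.-integrable setT (EFin \o (fun x : R => `|rho (x - hn n) - rho x|)).
    exact: integrable_norm iB.
  rewrite (@le_trans _ _ (\int[mu]_x (l * k * `|rho (x - hn n) - rho x|)))//.
    apply: le_Rintegral => //.
    - exact: integrable_norm iKB.
    - by apply: (imul _ iaB (fun=> l * k) `|l * k|).
    - by move=> x _; rewrite normrM ler_wpM2r.
  rewrite RintegralZl//.
  rewrite mulrCA ler_wpM2l//; first by rewrite mulr_ge0// ltW.
  exact: BVle.
have iAF : mu.-integrable setT (EFin \o (fun x => (A x - F x) * rho x)).
  apply: (imul _ irho _ 2); first exact: measurable_funB.
  by move=> x; rewrite (le_trans (ler_normB _ _))// -[2]/(1 + 1) lerD.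
have lim_le : `|\int[mu]_x ((A x - F x) * rho x)| <= l * k * B.
  have := @dominated_convergence _ _ _ mu setT measurableT
    (fun n x => (D n x * rho x)%:E) (fun x => ((A x - F x) * rho x)%:E)
    (fun x => (2 * `|rho x|)%:E).
  case.
  - by move=> n; exact: measurable_int (imul _ irho _ 2 (mD n) (D2 n)).
  - exact: measurable_int iAF.
  - apply: aeW => x _; apply: cvg_EFin; first exact: nearW.
    apply: cvgM; [exact: Dcvg|exact: cvg_cst].
  - apply: (imul _ (integrable_norm irho) (fun=> 2) 2) => //.
    by move=> x; rewrite ger0_norm.
  - apply: aeW => x n _ /=; rewrite lee_fin normrM ler_wpM2r//.
  move=> _ _ cv.
  have fcv : (fun n => \int[mu]_x (D n x * rho x)) n @[n --> \oo] -->
      \int[mu]_x ((A x - F x) * rho x).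
    apply: fine_cvg; rewrite /Rintegral fineK//.
    exact: integrable_fin_num.
  apply: (ler_cvg_to (cvg_norm fcv) (cvg_cst (l * k * B))).
  by apply: nearW => n; exact: Dint.
rewrite (Rintegral_density dens mF F1).
have iA := imul _ irho A 1 mA A1.
have -> : \int[mu]_x (F x * rho x) =
    \int[mu]_x (A x * rho x) - \int[mu]_x ((A x - F x) * rho x).
  by rewrite -RintegralB//; apply: eq_Rintegral => x _; ring.
rewrite -(Rintegral_density dens mA A1).
rewrite (le_trans (ler_normB _ _))//.
have := normr_Rintegral_le nu mA Ak.
have : l * k * B <= k by rewrite mulrAC ler_piMl.
by lra.
Unshelve. all: by end_near. Qed.

End spread.

(** * Integrating out one coordinate *)

Section coordinate_polynomial.
Context {R : realType} {n : nat}.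
Implicit Types (f : mpoly n R) (x : n.-tuple (measurableTypeR R)) (i : 'I_n).

(** The restriction of [f] to the line through [x] parallel to the axis [i]. *)
Definition coord_poly f i x : {poly R} :=
  mmap (@polyC R) (fun k => if k == i then 'X else (tnth x k)%:P) f.

Lemma horner_coord_poly f i x (t : R) :
  (coord_poly f i x).[t] = mpoly_fun f (upd x i t).
Proof.
rewrite /coord_poly /mpoly_fun mevalE /mmap horner_sum; apply: eq_bigr => j _.
rewrite hornerM hornerC /mmap1 horner_prod; congr (_ * _).
apply: eq_bigr => k _; rewrite horner_exp tnth_upd.
by case: eqP => _; rewrite ?hornerX ?hornerC.
Qed.

Lemma mmap1_coord i x (j : multinom n) :
  mmap1 (fun k => if k == i then 'X else (tnth x k : R)%:P) j =
  (\prod_(k | k != i) (tnth x k : R) ^+ j k)%:P * 'X^(j i).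
Proof.
rewrite /mmap1 (bigD1 i)//= eqxx mulrC; congr (_ * _).
rewrite rmorph_prod; apply: eq_bigr => k /negbTE ->.
by rewrite rmorphXn.
Qed.

Lemma size_coord_poly f i x m : (forall j, j \in msupp f -> (j i <= m)%N) ->
  (size (coord_poly f i x) <= m.+1)%N.
Proof.
move=> fm; rewrite /coord_poly /mmap (leq_trans (size_sum _ _ _))//.
apply/bigmax_leqP_seq => j jf _; rewrite mmap1_coord mulrA -polyCM mul_polyC.
by rewrite (leq_trans (size_scale_leq _ _))// size_polyXn ltnS fm.
Qed.

Lemma deriv_coord_poly f i x :
  (coord_poly f i x)^`() = coord_poly (mderiv i f) i x.
Proof.
have CX (a c : R) k : a%:P * (c%:P * 'X^k) = (a * c) *: 'X^k.
  by rewrite mulrA -polyCM mul_polyC.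
rewrite /coord_poly {1}/mmap /mderiv [LHS]raddf_sum [RHS]raddf_sum.
apply: eq_bigr => j _; rewrite /= mmapZ mmapX !mmap1_coord !CX mnmBE mnm1E.
rewrite eqxx subn1 derivZ derivXn -scaler_nat scalerA; congr (_ *: _).
rewrite mulrC mulrA; congr (_ * _).
by apply: eq_bigr => k ki; rewrite mnmBE mnm1E eq_sym (negbTE ki) subn0.
Qed.

End coordinate_polynomial.

(** * Averaging one-variable estimates over parallel lines *)

Section one_coordinate.
Context {R : realType} {n : nat}.
Implicit Types (f : mpoly n R) (x : n.-tuple (measurableTypeR R)) (i : 'I_n).

Lemma continuous_comp_horner (psi : R -> R) (p : {poly R}) :
  continuous psi -> continuous (psi \o horner p).
Proof.
move=> cpsi t; apply: continuous_comp; [exact: continuous_horner|exact: cpsi].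
Qed.

Lemma continuous_mpoly_fun_upd (psi : R -> R) f i x : continuous psi ->
  continuous (fun t : R => psi (mpoly_fun f (upd x i t))).
Proof.
move=> cpsi; under eq_fun do rewrite -horner_coord_poly.
exact: continuous_comp_horner.
Qed.

Lemma measurable_comp_mpoly_fun (psi : R -> R) f : continuous psi ->
  measurable_fun setT (psi \o mpoly_fun f).
Proof.
move=> cpsi; apply: measurableT_comp; first exact: continuous_measurable_fun.
exact: measurable_mpoly_fun.
Qed.

(** Dominated convergence; [spread] only tests continuous functions. *)
Lemma continuous_Rintegral_upd (P : probability (n.-tuple (measurableTypeR R)) R)
    (psi : R -> R) f i : continuous psi -> (forall u, `|psi u| <= 1) ->
  continuous (fun t : R => \int[P]_x psi (mpoly_fun f (upd x i t))).
Proof.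
move=> cpsi psi1 t.
have mt (u : R) : measurable_fun setT (fun x => psi (mpoly_fun f (upd x i u))).
  have mh := measurableT_comp (measurable_comp_mpoly_fun f cpsi)
    (measurable_upd_pair (T := measurableTypeR R) i).
  exact: (measurableT_comp mh (measurable_pair1 u)).
have iP (h : n.-tuple (measurableTypeR R) -> R) : measurable_fun setT h ->
    (forall x, `|h x| <= 1) -> P.-integrable setT (EFin \o h).
  by move=> mh h1; exact: (bounded_integrable P measurableT mh h1).
apply: (@continuity_under_integral R _ _ P
  (fun t x => psi (mpoly_fun f (upd x i t))) setT measurableT
  (t - 1) (t + 1) _ _ (cst 1)).
- by move=> u _; exact: iP.
- by apply: aeW => x _ u _; exact: continuous_mpoly_fun_upd.
- by apply: iP => // x; rewrite normr1.
- by move=> u _; apply: aeW => x _; exact: psi1.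
- by rewrite inE/= in_itv/= ltrBlDr ltrDl ltr01.
Qed.

Variables (P : 'I_n -> probability (measurableTypeR R) R) (i : 'I_n).
Variables (f : mpoly n R) (l : R) (psi g : R -> R) (c e M : R).
Hypotheses (l0 : 0 < l) (sprP : spread l (P i)).
Hypotheses (cpsi : continuous psi) (psi1 : forall u, `|psi u| <= 1).
Hypotheses (cg : continuous g) (gM : forall u, `|g u| <= M).
(** On each line the increment costs [l * c], uniformly in [x], plus [l] times the mean of
    [g (mderiv i f)] over the segment [[s, s + l]]. The hypothesis [average] bounds this mean after
    integration over all lines, that is, under the law whose coordinate [i] is uniform on the
    segment. *)
Hypothesis pointwise : forall x (s b : R) (G H : R -> R), s <= b -> b <= s + l ->
  (forall t : R, is_derive t 1 G (psi (coord_poly f i x).[t])) ->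
  (forall t : R, is_derive t 1 H (g (coord_poly f i x)^`().[t])) ->
  `|G b - G s| <= l * c + (H (s + l) - H s).
Hypothesis average : forall (s : R) (sl : s < s + l),
  \int[product_probability (updP P i (uniform_prob sl))]_x
    g (mpoly_fun (mderiv i f) x) <= e.

Let PP := product_probability P.

Let mjoint (q : mpoly n R) (phi : R -> R) : continuous phi -> measurable_fun setT
  (fun z : measurableTypeR R * n.-tuple (measurableTypeR R) =>
     phi (mpoly_fun q (upd z.2 i z.1))).
Proof.
move=> cphi; exact: (measurableT_comp (measurable_comp_mpoly_fun q cphi)
  (measurable_upd_pair (T := measurableTypeR R) i)).
Qed.

Let ss (s : R) : s < s + l. Proof. by rewrite ltrDl. Qed.

(** By Fubini the increment of [G] is the average over [x] of the increments along the lines;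
    [pointwise] bounds each of them, and Fubini again turns the mean of the [H] terms into the
    integral in [average]. *)
Let increment_le (G : R -> R) (s b : R) : s < b -> b <= s + l ->
  (forall t : R, is_derive t 1 G (\int[PP]_x psi (mpoly_fun f (upd x i t)))) ->
  `|G b - G s| <= l * (c + e).
Proof.
move=> sb bl GE.
pose J x := \int[uniform_prob sb]_t psi (mpoly_fun f (upd x i t)).
pose J' x := \int[uniform_prob (ss s)]_t g (mpoly_fun (mderiv i f) (upd x i t)).
have bs0 : 0 < b - s by rewrite subr_gt0.
have GJ : G b - G s = (b - s) * \int[PP]_x J x.
  have cF := continuous_Rintegral_upd (P := PP) (f := f) (i := i) cpsi psi1.
  have F1 t : `|\int[PP]_x psi (mpoly_fun f (upd x i t))| <= 1.
    apply: normr_Rintegral_le => //.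
    exact: (measurableT_comp (mjoint f cpsi) (measurable_pair1 t)).
  have <- : \int[uniform_prob sb]_t \int[PP]_x psi (mpoly_fun f (upd x i t)) =
      \int[PP]_x J x.
    exact: (Rintegral_Fubini (uniform_prob sb) PP (mjoint f cpsi) (M := 1)).
  rewrite (Rintegral_uniform sb cF F1 GE) mulrC divfK//.
  by rewrite gt_eqF.
have mJ : measurable_fun setT J.
  exact: (measurable_Rintegral2 (uniform_prob sb) PP (mjoint f cpsi) (M := 1)).
have mJ' : measurable_fun setT J'.
  exact: (measurable_Rintegral2 (uniform_prob (ss s)) PP
    (mjoint (mderiv i f) cg) (M := M)).
have J1 x : `|J x| <= 1.
  apply: normr_Rintegral_le => //.
  exact: (measurableT_comp (mjoint f cpsi) (measurable_pair2 x)).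
have J'M x : `|J' x| <= M.
  apply: normr_Rintegral_le => //.
  exact: (measurableT_comp (mjoint (mderiv i f) cg) (measurable_pair2 x)).
have iJ : PP.-integrable setT (EFin \o J).
  exact: (bounded_integrable PP measurableT mJ J1).
have iJ' : PP.-integrable setT (EFin \o J').
  exact: (bounded_integrable PP measurableT mJ' J'M).
have J'e : \int[PP]_x J' x <= e.
  apply: le_trans (average (ss s)); rewrite le_eqVlt; apply/predU1P; left.
  rewrite (Rintegral_updP P i (uniform_prob (ss s))
    (measurable_comp_mpoly_fun (mderiv i f) cg) (fun x => gM _)).
  exact/esym/(Rintegral_Fubini (uniform_prob (ss s)) PP
    (mjoint (mderiv i f) cg) (M := M)).
have JJ' x : (b - s) * `|J x| <= l * c + l * J' x.
  have cp := continuous_comp_horner (p := coord_poly f i x) cpsi.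
  have [Gx GxE] := continuous_primitive cp.
  have cq := continuous_comp_horner (p := (coord_poly f i x)^`()) cg.
  have [Hx HxE] := continuous_primitive cq.
  have -> : J x = (Gx b - Gx s) / (b - s).
    rewrite /J; under eq_Rintegral do rewrite -horner_coord_poly.
    exact: (Rintegral_uniform sb cp (fun t => psi1 _) GxE).
  have -> : J' x = (Hx (s + l) - Hx s) / (s + l - s).
    rewrite /J'; under eq_Rintegral do rewrite -horner_coord_poly -deriv_coord_poly.
    exact: (Rintegral_uniform (ss s) cq (fun t => gM _) HxE).
  rewrite normrM (gtr0_norm (x := (b - s)^-1)) ?invr_gt0//.
  rewrite mulrCA mulfV ?gt_eqF// mulr1 (_ : s + l - s = l); last by ring.
  rewrite (mulrC l ((_ - _) / _)) divfK ?gt_eqF//.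
  exact: (pointwise (ltW sb) bl GxE HxE).
rewrite GJ normrM gtr0_norm//.
have iaJ : PP.-integrable setT (EFin \o (fun x => `|J x|)).
  exact: integrable_norm iJ.
have icst : PP.-integrable setT (EFin \o (fun=> l * c)).
  by apply: (bounded_integrable (M := `|l * c|) PP measurableT).
have ilJ' : PP.-integrable setT (EFin \o (fun x => l * J' x)).
  apply: (bounded_integrable (M := l * M) PP measurableT).
    exact: measurable_funM.
  by move=> x; rewrite normrM gtr0_norm// ler_pM2l.
rewrite (@le_trans _ _ ((b - s) * \int[PP]_x `|J x|))//.
  by rewrite ler_pM2l//; exact: le_normr_Rintegral.
rewrite -RintegralZl// (@le_trans _ _ (\int[PP]_x (l * c + l * J' x)))//.
  apply: le_Rintegral => //.
  - apply: (bounded_integrable (M := b - s) PP measurableT).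
      by apply: measurable_funM => //; exact: measurableT_comp.
    by move=> x; rewrite normrM normr_id gtr0_norm// ler_piMr// ltW.
  - exact: (integrableD measurableT icst ilJ').
rewrite RintegralD// Rintegral_cst// RintegralZl//.
have /(congr1 fine) /= -> := probability_setT PP.
by rewrite mulr1 mulrDr lerD2l ler_pM2l.
Qed.

(** With coordinate [i] isolated, [spread] applied to the partial expectation as a function of [t]
    leaves only its increments over intervals of length at most [l]. *)
Lemma normr_Rintegral_le_average :
  `|\int[PP]_x psi (mpoly_fun f x)| <= 2 * (c + e).
Proof.
have -> : \int[PP]_x psi (mpoly_fun f x) =
    \int[P i]_t \int[PP]_x psi (mpoly_fun f (upd x i t)).
  rewrite -{1}[PP]/(product_probability P) -{1}(updP_id P i).
  exact: (Rintegral_updP P i (P i) (measurable_comp_mpoly_fun f cpsi)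
    (fun x => psi1 _)).
have cF := continuous_Rintegral_upd (P := PP) (f := f) (i := i) cpsi psi1.
have [G GE] := continuous_primitive cF.
apply: (sprP cF _ GE) => [t|s b sb bl].
  apply: normr_Rintegral_le => //.
  exact: (measurableT_comp (mjoint f cpsi) (measurable_pair1 t)).
move: sb; rewrite le_eqVlt => /predU1P[<-|sb]; last exact: increment_le.
(* For [s = b] it suffices that [l * (c + e)] is nonnegative, which the bound on [[s, s + l]]
   shows. *)
by rewrite subrr normr0 (le_trans _ (increment_le (ss s) (lexx _) GE)).
Qed.

End one_coordinate.

(** * A smooth substitute for the indicator of an interval *)

Section lorentz.
Context {R : realType}.
Implicit Types (delta u : R).

(** Twice this kernel dominates the indicator of [[- delta, delta]], and the kernel is the
    derivative of [delta * atan (u / delta)], of size at most [2 * delta]; so bounds on oscillatory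
    expectations apply to it. *)
Definition lorentz delta u : R := (1 + (u / delta) ^+ 2)^-1.

Let denom_gt0 delta u : 0 < 1 + (u / delta) ^+ 2.
Proof. by rewrite ltr_pwDl// exprn_even_ge0. Qed.

Lemma lorentz_gt0 delta u : 0 < lorentz delta u.
Proof. by rewrite invr_gt0. Qed.

Lemma normr_lorentz_le1 delta u : `|lorentz delta u| <= 1.
Proof.
by rewrite gtr0_norm ?lorentz_gt0// invf_le1// lerDl exprn_even_ge0.
Qed.

Lemma lorentz_ge delta u : 0 < delta -> `|u| <= delta ->
  1 <= 2 * lorentz delta u.
Proof.
move=> d0 ud; rewrite ler_pdivlMr// mul1r.
suff : (u / delta) ^+ 2 <= 1 by lra.
by rewrite -real_normK ?num_real// expr_le1// normrM normfV (gtr0_norm d0)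
  ler_pdivrMr// mul1r.
Qed.

Lemma is_derive_lorentz delta (u : R) : delta != 0 ->
  is_derive u 1 (fun v => delta * atan (v / delta)) (lorentz delta u).
Proof.
move=> d0.
have h1 : is_derive u 1 (fun v : R => v * delta^-1) (u *: 0 + delta^-1 *: 1).
  exact: (is_deriveM (is_derive_id u 1) (is_derive_cst delta^-1 u 1)).
have h2 := @is_derive1_comp R atan (fun v => v * delta^-1) u _ _
  (is_derive1_atan _) h1.
have h3 := is_deriveZ delta h2.
apply: (is_derive_eq h3).
rewrite /lorentz /GRing.scale /= mulr0 add0r mulr1.
by rewrite mulrCA mulfV// mulr1.
Qed.

Lemma normr_atan_le (x : R) : `|atan x| <= 2.
Proof.
have p2 := @pihalf_lt2 R.
rewrite ler_norml; apply/andP; split.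
  by rewrite ltW// (lt_trans _ (atan_gtNpi2 x))// ltrN2.
by rewrite ltW// (lt_trans (atan_ltpi2 x)).
Qed.

Lemma continuous_lorentz delta : continuous (lorentz delta).
Proof.
move=> u; apply: cvgV; first by rewrite gt_eqF.
apply: cvgD; first exact: cvg_cst.
have h : v / delta @[v --> u] --> u / delta.
  by apply: cvgM; [exact: cvg_id|exact: cvg_cst].
exact: (cvgM h h).
Qed.

End lorentz.

(** * Degrees and large coefficients under differentiation *)

Section polynomial_classes.
Context {R : realType} {n : nat}.
Implicit Types (f : mpoly n R).

(** One large coefficient in degree [d] replaces [top_coef_norm] in the induction, as it passes to a
    suitable partial derivative with the same [c]. *)
Definition monomial_ge f (d : nat) (c : R) : Prop :=
  exists2 j, mdeg j = d & c <= `|mcoeff j f|.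

Lemma mpoly_dm_mderiv d m f i : mpoly_dm d.+1 m f ->
  mpoly_dm d m (mderiv i f).
Proof.
move=> fdm j; rewrite mcoeff_msupp mcoeff_deriv => h.
have /fdm[] : mnm_add j (mnm1 i) \in msupp f.
  by rewrite mcoeff_msupp; apply: contraNneq h => ->; rewrite mul0rn.
rewrite mdegD mdeg1 addn1 ltnS => dj hj; split => // k.
by apply: leq_trans (hj k); rewrite mnmDE leq_addr.
Qed.

(** Differentiating in a variable of the monomial multiplies its coefficient by an exponent, at
    least 1. *)
Lemma monomial_ge_mderiv d c f : 0 < c -> monomial_ge f d.+1 c ->
  exists i, monomial_ge (mderiv i f) d c.
Proof.
move=> c0 [j jd cj].
have [i ji] : exists i, (0 < j i)%N.
  apply/existsP; rewrite -[X in is_true X]negbK; apply/negP => /existsPn h.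
  move: jd; rewrite mdegE big1// => i _; apply/eqP.
  by have := h i; rewrite -eqn0Ngt.
have jE : mnm_add (mnm_sub j (mnm1 i)) (mnm1 i) = j.
  apply: submK; apply/mnm_lepP => k; rewrite mnm1E.
  by case: eqP => [<-|].
exists i, (mnm_sub j (mnm1 i)).
  by move: jd; rewrite -{1}jE mdegD mdeg1 addn1 => -[].
rewrite mcoeff_deriv jE normrMn (le_trans cj)// -[leLHS]mulr1n.
by rewrite ler_wpMn2l.
Qed.

(** Partial degrees never exceed the total degree; hence both bounds can drop together when they are
    equal. *)
Lemma mpoly_dmW d m m' f : (d <= m')%N -> mpoly_dm d m f -> mpoly_dm d m' f.
Proof.
move=> dm fdm j /fdm[dj _]; split => // i; apply: leq_trans dm.
apply: leq_trans dj; rewrite mdegE (bigD1 i)//= leq_addr//.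
Qed.

Lemma mpoly_dm0 m f (x : n.-tuple (measurableTypeR R)) c : mpoly_dm 0 m f ->
  monomial_ge f 0 c -> c <= `|mpoly_fun f x|.
Proof.
move=> f0 [j /eqP]; rewrite mdeg_eq0 => /eqP-> h.
suff -> : f = mpolyC n (mcoeff mnm0 f) by rewrite /mpoly_fun mevalC.
apply/mpolyP => k; rewrite mcoeffC; case: eqP => [->|/eqP k0]; rewrite ?mulr1//.
rewrite mulr0; apply: memN_msupp_eq0; apply/negP => /f0[].
by rewrite leqn0 mdeg_eq0 (negbTE k0).
Qed.

End polynomial_classes.

(** * Induction on the degree *)

Section induction.
Context {R : realType}.

(* [S r] bounds the expectation of [dphi (f x)] in terms of the ratio
   [r = eps / (l ^ d * c)] *)
Definition oscillation_bound (d m : nat) (S : R -> R) : Prop :=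
  forall n (P : 'I_n -> probability (measurableTypeR R) R) (f : mpoly n R)
    (l c eps : R) (phi dphi : R -> R), 0 < l -> (forall i, spread l (P i)) ->
  0 < c -> mpoly_dm d m f -> monomial_ge f d c -> 0 < eps ->
  (forall u : R, is_derive u 1 phi (dphi u)) -> continuous dphi ->
  (forall u, `|phi u| <= eps) -> (forall u, `|dphi u| <= 1) ->
  `|\int[product_probability P]_x dphi (mpoly_fun f x)| <= S (eps / (l ^+ d * c)).

Lemma spread_updP l n (P : 'I_n -> probability (measurableTypeR R) R) i (s : R)
    (sl : s < s + l) : (forall j, spread l (P j)) ->
  forall j, spread l (updP P i (uniform_prob sl) j).
Proof.
by move=> Pl j; rewrite /updP; case: ifP => // _; exact: spread_uniform.
Qed.

Lemma oscillation_bound_lorentz d m S : oscillation_bound d m S ->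
  forall n (P : 'I_n -> probability (measurableTypeR R) R) (f : mpoly n R)
    (l c delta : R), 0 < l -> (forall i, spread l (P i)) ->
  0 < c -> mpoly_dm d m f -> monomial_ge f d c -> 0 < delta ->
  \int[product_probability P]_x lorentz delta (mpoly_fun f x) <=
    S (2 * delta / (l ^+ d * c)).
Proof.
move=> bS n P f l c delta l0 Pl c0 fdm fc delta0.
apply: le_trans (ler_norm _) _.
apply: (bS n P f l c (2 * delta) (fun v => delta * atan (v / delta))) => //.
- by rewrite mulr_gt0.
- by move=> u; apply: is_derive_lorentz; rewrite gt_eqF.
- exact: continuous_lorentz.
- by move=> u; rewrite normrM gtr0_norm// mulrC ler_pM2r// normr_atan_le.
- by move=> u; exact: normr_lorentz_le1.
Qed.

Lemma powR_root m (r : R) : 0 <= r -> (r `^ m.+1%:R^-1) ^+ m.+1 = r.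
Proof.
by move=> r0; rewrite -powR_mulrn ?powR_ge0// -powRrM mulVf// powRr1.
Qed.

Lemma root_powR m (v : R) : 0 <= v -> (v ^+ m.+1) `^ m.+1%:R^-1 = v.
Proof. by move=> v0; rewrite -powR_mulrn// -powRrM mulfV// powRr1. Qed.

Lemma powR_root2 m (v : R) : 0 <= v -> (2 * v ^+ m.+1) `^ m.+1%:R^-1 <= 2 * v.
Proof.
move=> v0; rewrite powRM ?exprn_ge0// root_powR// ler_wpM2r//.
by rewrite ler1_powR ?ler1n// invf_le1 ?ler1n ?ltr0n.
Qed.

(** Here [mderiv i f] is a constant of size at least [c]: no sublevel set remains, and [g = 0] is
    taken. *)
Lemma oscillation_bound1 : exists2 C : R, 1 <= C &
  oscillation_bound 1 1 (fun r => C * r `^ 1%:R^-1).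
Proof.
have [C C1 hC] := @normr_increment_le_root R 0.
exists (2 * C); first by lra.
move=> n P f l c eps phi dphi l0 Pl c0 fdm fc eps0 phiE cdphi phi_le dphi1.
have [i f'c] := monomial_ge_mderiv c0 fc.
have f'dm := mpoly_dm_mderiv (i := i) fdm.
rewrite expr1 invr1 powRr1; last by rewrite divr_ge0 ?ltW// mulr_gt0.
set r := eps / (l * c).
have r0 : 0 < r by rewrite divr_gt0// mulr_gt0.
rewrite -mulrA -[X in 2 * X]addr0.
apply: (@normr_Rintegral_le_average R n P i f l dphi (cst 0) (C * r) 0 0) => //.
- exact: cst_continuous.
- by move=> u; rewrite normr0.
- move=> x s b G H sb bl GE HE.
  have -> : H (s + l) - H s = 0.
    have [||t _ ->] := @MVT_segment R H (cst 0) s (s + l); last by rewrite mul0r.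
    - by rewrite lerDl ltW.
    - by apply: derivable_within_continuous => y _; have [] := HE y.
  rewrite addr0 mulrCA.
  apply: (hC (coord_poly f i x) phi dphi G eps s l s b c r) => //.
  + by apply: size_coord_poly => j /fdm[].
  + by rewrite expr1 /r divfK// gt_eqF// mulr_gt0.
  + exists s; first by rewrite lexx lerDl ltW.
    by rewrite deriv_coord_poly horner_coord_poly; exact: mpoly_dm0 f'dm f'c.
- by move=> s sl; rewrite Rintegral_cst// mul0r.
Qed.

Lemma oscillation_bound_full m : exists2 C : R, 1 <= C &
  oscillation_bound m.+1 m.+1 (fun r => C * r `^ m.+1%:R^-1).
Proof.
elim: m => [|m [C C1 IH]]; first exact: oscillation_bound1.
pose K : R := 4 *+ 2 ^ (3 * m.+2).
have K0 : 0 <= K by rewrite mulrn_wge0.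
exists (2 * (K + 4 * C)); first by lra.
move=> n P f l c eps phi dphi l0 Pl c0 fdm fc eps0 phiE cdphi phi_le dphi1.
have [i f'c] := monomial_ge_mderiv c0 fc.
have f'dm := mpoly_dmW (leqnn _) (mpoly_dm_mderiv (i := i) fdm).
set r := eps / (l ^+ m.+2 * c).
have r0 : 0 < r by rewrite divr_gt0// mulr_gt0// exprn_gt0.
set v := r `^ m.+2%:R^-1.
have v0 : 0 < v by rewrite powR_gt0.
have vr : v ^+ m.+2 = r by rewrite powR_root// ltW.
(* This choice makes [eps / delta = l * v], while the induction hypothesis bounds the sublevel term
   by a multiple of the root of order [m.+1] of [v ^+ m.+1]: both errors are of order [v]. *)
pose delta := l ^+ m.+1 * c * v ^+ m.+1.
have delta0 : 0 < delta by rewrite !mulr_gt0// exprn_gt0.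
have epsE : eps = delta * (l * v).
  have : eps = r * (l ^+ m.+2 * c) by rewrite divfK// gt_eqF// mulr_gt0// exprn_gt0.
  by move=> ->; rewrite -vr /delta (exprS v) (exprS l); ring.
have -> : 2 * (K + 4 * C) * v = 2 * (K * v + 4 * C * v) by ring.
apply: (@normr_Rintegral_le_average R n P i f l dphi
  (fun u => 2 * lorentz delta u) (K * v) (4 * C * v) 2) => //.
- by move=> u; apply: cvgM; [exact: cvg_cst|exact: continuous_lorentz].
- by move=> u; rewrite normrM ger0_norm// ler_piMr// normr_lorentz_le1.
- move=> x s b G H sb bl GE HE.
  have -> : l * (K * v) = (4 * (eps / delta)) *+ 2 ^ (3 * m.+2).
    rewrite {1}epsE mulrAC mulfV ?gt_eqF// mul1r /K -[in RHS]mulrnAl; ring.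
  (* Since [g] is nonnegative, the segment may be enlarged to full length [l]. *)
  have HsE : H b - H s <= H (s + l) - H s.
    rewrite lerD2r -subr_ge0.
    have := @le_increment _ (cst 0) H (cst 0)
      (fun t => 2 * lorentz delta (coord_poly f i x)^`().[t]) b (s + l) bl.
    rewrite /= subrr; apply => // t _.
    by rewrite mulr_ge0// ltW// lorentz_gt0.
  apply: le_trans (lerD (lexx _) HsE).
  apply: (@normr_increment_le_sublevel R m.+1 (coord_poly f i x) phi dphi
    (fun u => 2 * lorentz delta u)) => //.
  + by apply: size_coord_poly => j /fdm[].
  + by move=> u; rewrite mulr_ge0// ltW// lorentz_gt0.
  + by move=> u; exact: lorentz_ge.
- move=> s sl.
  have m' := measurable_comp_mpoly_fun (mderiv i f) (@continuous_lorentz R delta).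
  rewrite RintegralZl//; last first.
    apply: (bounded_integrable (M := 1) _ measurableT m').
    by move=> x; exact: normr_lorentz_le1.
  have := oscillation_bound_lorentz IH l0 (spread_updP i sl Pl) c0 f'dm f'c delta0.
  have -> : 2 * delta / (l ^+ m.+1 * c) = 2 * v ^+ m.+1.
    by rewrite /delta; field; rewrite ?gt_eqF// exprn_gt0.
  have := powR_root2 m (ltW v0) => h1 h2.
  have : C * (2 * v ^+ m.+1) `^ m.+1%:R^-1 <= C * (2 * v).
    by rewrite ler_wpM2l//; lra.
  by lra.
Qed.

End induction.

(** * A geometric cascade of thresholds *)

Section logarithmic_factor.
Context {R : realType}.

(** Truncating the logarithm at 0 makes this factor nonincreasing on positive reals, which
    [|ln r| + 1] is not. *)
Definition Lg (r : R) : R := 1 + Num.max 0 (- ln r).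

Lemma Lg_ge1 r : 1 <= Lg r.
Proof. by rewrite /Lg lerDl le_max lexx. Qed.

Lemma Lg_anti r r' : 0 < r -> r <= r' -> Lg r' <= Lg r.
Proof.
move=> r0 rr'; rewrite /Lg lerD2l ge_max le_max lexx /=.
by rewrite le_max lerN2 ler_ln ?posrE// ?rr' ?orbT// (lt_le_trans r0).
Qed.

Section cascade.
Variables (n m : nat) (x : n.-tuple (measurableTypeR R)) (f : mpoly n R).
Variables (i : 'I_n) (N : nat) (C A l eps v La s b : R) (phi dphi G H : R -> R).
Hypotheses (C1 : 1 <= C) (A1 : 1 <= A) (AC : C * expR 1 <= A).
Hypotheses (l0 : 0 < l) (eps0 : 0 < eps) (v0 : 0 < v).
Hypothesis vE : eps = v ^+ m.+1 * La.
Hypothesis LaN : La <= expR N%:R ^+ m.+1 * eps.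
Hypotheses (sb : s <= b) (bl : b <= s + l).

Let p := coord_poly f i x.
(** If [|p'|] reaches [delta k], then [root_bound] with [u = expR (- k)] bounds the increment by
    [C * l * expR (- k)]; this dictates the weights in [g]. *)
Let delta k := expR k%:R ^+ m.+1 * eps / l.
Let g u := \sum_(k < N.+1) A * expR (- k%:R) * (2 * lorentz (delta k) u).

Hypothesis GE : forall t : R, is_derive t 1 G (dphi p.[t]).
Hypothesis HE : forall t : R, is_derive t 1 H (g p^`().[t]).
Hypothesis dphi1 : forall u, `|dphi u| <= 1.
Hypothesis root_bound : forall (M u : R), 0 < M -> 0 < u ->
  eps <= u ^+ m.+1 * (l * M) ->
  (exists2 t, s <= t <= s + l & M <= `|p^`().[t]|) ->
  `|G b - G s| <= C * (l * u).

Let delta0 k : 0 < delta k.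
Proof. by rewrite divr_gt0// mulr_gt0// exprn_gt0// expR_gt0. Qed.

Let A0 : 0 <= A. Proof. exact: le_trans ler01 A1. Qed.

Let C0 : 0 <= C. Proof. exact: le_trans ler01 C1. Qed.

Let term_ge0 k u : 0 <= A * expR (- k%:R) * (2 * lorentz (delta k) u).
Proof.
by rewrite !mulr_ge0 ?A0 ?expR_ge0// (ltW (lorentz_gt0 _ _)).
Qed.

Let H_ge k : (k < N.+1)%N ->
  (forall t, s <= t <= s + l -> `|p^`().[t]| <= delta k) ->
  A * expR (- k%:R) * l <= H (s + l) - H s.
Proof.
move=> kN pk; have sl : s <= s + l by rewrite lerDl ltW.
have LE (t : R) : is_derive t 1 (fun t => t * (A * expR (- k%:R)))
    (A * expR (- k%:R)).
  have := is_deriveM (is_derive_id t 1) (is_derive_cst (A * expR (- k%:R)) t 1).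
  by rewrite scaler0 add0r /GRing.scale /= mulr1.
have := le_increment sl (fun t _ => LE t) (fun t _ => HE t).
rewrite -mulrBl (_ : s + l - s = l); last by ring.
rewrite [l * _]mulrC; apply => t /andP[st tl].
rewrite /g (bigD1 (Ordinal kN))//= ler_wpDr//.
  by apply: sumr_ge0 => j _; exact: term_ge0.
rewrite -[leLHS]mulr1 ler_wpM2l ?mulr_ge0 ?expR_ge0//.
by apply: lorentz_ge => //; apply: pk; rewrite !ltW.
Qed.

(** If [|p'|] reaches [La / l], [root_bound] with [u = v] is enough. Otherwise [|p'|] stays below
    some threshold, and the term of [g] at the least such threshold alone pays for the increment. *)
Lemma increment_le_cascade :
  `|G b - G s| <= l * (C * v) + (H (s + l) - H s).
Proof.
have sl : s <= s + l by rewrite lerDl ltW.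
have H0 : 0 <= H (s + l) - H s.
  have := @le_increment _ (cst 0) H (cst 0) _ s (s + l) sl _ (fun t _ => HE t).
  rewrite /= subrr; apply => // t _.
  by apply: sumr_ge0 => k _; exact: term_ge0.
have Cv0 : 0 <= l * (C * v) by rewrite !mulr_ge0 ?(ltW v0) ?(ltW l0).
have La0 : 0 < La.
  by rewrite -(pmulr_rgt0 _ (exprn_gt0 m.+1 v0)) -vE.
have [[t tl Lat]|small] := pselect (exists2 t, s <= t <= s + l &
    La / l <= `|p^`().[t]|).
  apply: (@le_trans _ _ (C * (l * v))); last by rewrite mulrCA lerDl.
  apply: (root_bound (M := La / l)) => //; first by rewrite divr_gt0.
    by rewrite [l * _]mulrC divfK ?gt_eqF// -vE.
  by exists t.
pose Q k := `[< forall t, s <= t <= s + l -> `|p^`().[t]| <= delta k >].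
have QN : Q N.
  apply/asboolP => t tl; rewrite leNgt; apply/negP => lt; apply: small.
  exists t => //; rewrite (le_trans _ (ltW lt))// ler_wpM2r// ?invr_ge0 ltW//.

have exQ : exists k, Q k by exists N.
case: (ex_minnP exQ) => k /asboolP Qk kmin.
have kN : (k < N.+1)%N by rewrite ltnS kmin.
rewrite (@le_trans _ _ (A * expR (- k%:R) * l))//; last first.
  by rewrite (le_trans (H_ge kN Qk))// lerDr.
case: k => [|k] in Qk kmin kN *.
  (* Below the lowest threshold the trivial bound by the length suffices, as [A >= 1]. *)
  rewrite oppr0 expR0 mulr1.
  rewrite (le_trans (normr_increment_le sb GE (fun=> dphi1 _)))//.
  rewrite (@le_trans _ _ l)//; first by rewrite lerBlDl.
  by rewrite ler_peMl// ltW.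
have [t tl pt] : exists2 t, s <= t <= s + l & delta k <= `|p^`().[t]|.
  apply: contrapT => h.
  suff /kmin : Q k by rewrite ltnn.
  apply/asboolP => t tl; rewrite leNgt; apply/negP => lt; apply: h.
  by exists t => //; exact: ltW.
(* By minimality [|p'|] reaches the preceding threshold; the shift of index by one costs a factor
   [expR 1], absorbed in [A] by [AC]. *)
apply: (@le_trans _ _ (C * (l * expR (- k%:R)))).
  apply: (root_bound (delta0 k) (expR_gt0 (- k%:R))); last by exists t.
  rewrite /delta [l * _]mulrC divfK ?gt_eqF// mulrA -exprMn.
  by rewrite -expRD addNr expR0 expr1n mul1r.
rewrite [leRHS]mulrC [leLHS]mulrCA ler_pM2l// -addn1 natrD opprD expRD.
  rewrite [leRHS](_ : _ = A * expR (- 1) * expR (- k%:R)); last by ring.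
  rewrite ler_wpM2r ?expR_ge0// -(ler_pM2r (expR_gt0 1)) -mulrA -expRD.
  by rewrite addNr expR0 mulr1.
Qed.

End cascade.
End logarithmic_factor.

(** * One logarithm for each degree beyond the partial-degree bound *)

Section logarithmic_induction.
Context {R : realType}.

(** Induction on the excess [k] of the total degree: differentiation lowers it and keeps the bound
    on partial degrees. The thresholds contribute equal amounts, and their number is of order
    [Lg r]. *)
Lemma oscillation_bound_log m k : exists2 C : R, 1 <= C &
  oscillation_bound (m.+1 + k) m.+1
    (fun r => C * r `^ m.+1%:R^-1 * Lg r ^+ k).
Proof.
elim: k => [|k [C C1 IH]].
  have [C C1 hC] := @oscillation_bound_full R m; exists C => //.
  rewrite addn0 => n P f l c eps phi dphi *.
  by rewrite expr0 mulr1; apply: hC; eassumption.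
have [C' C'1 hC'] := @normr_increment_le_root R m.
pose A := C' * expR 1.
have e1 : 1 <= expR 1 :> R by rewrite -expR0 ler_expR.
have A1 : 1 <= A by rewrite mulr_ege1.
have A0 : 0 <= A by lra.
have C0 : 0 <= C by lra.
exists (2 * (C' + 8 * A * C)).
  have : 0 <= A * C by rewrite mulr_ge0.
  by lra.
move=> n P f l c eps phi dphi l0 Pl c0 fdm fc eps0 phiE cdphi phi_le dphi1.
rewrite addnS in fdm fc *.
set d := (m.+1 + k)%N in fdm fc IH *.
pose La := l ^+ d.+1 * c.
have La0 : 0 < La by rewrite mulr_gt0// exprn_gt0.
rewrite -/La; set r := eps / La.
have r0 : 0 < r by rewrite divr_gt0.
set v := r `^ m.+1%:R^-1.
have v0 : 0 < v by rewrite powR_gt0.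
have vr : v ^+ m.+1 = r by rewrite powR_root// ltW.
have L1 := @Lg_ge1 R r.
have L0 : 0 <= Lg r by lra.
have AC0 : 0 <= A * C by rewrite mulr_ge0.
have [i f'c] := monomial_ge_mderiv c0 fc.
have f'dm := mpoly_dm_mderiv (i := i) fdm.
(* For [r >= 1] the right-hand side is at least 1, which bounds the expectation trivially. *)
have [r1|r1] := leP 1 r.
  apply: (@le_trans _ _ 1).
    apply: normr_Rintegral_le => //; exact: measurable_comp_mpoly_fun.
  have v1 : 1 <= v.
    rewrite leNgt; apply/negP => v1.
    by move: r1; rewrite -vr leNgt exprn_ilt1// ltW.
  rewrite mulr_ege1// ?exprn_ege1// mulr_ege1//; lra.
(* The successor ensures [expR N >= La / eps], so that the last threshold is above [La / l]. *)
pose N := (Num.truncn (- ln r)).+1.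
have lnr0 : 0 <= - ln r by rewrite oppr_ge0 ln_le0// ltW.
have NL : N.+1%:R <= 2 * Lg r.
  have : (Num.truncn (- ln r))%:R <= - ln r by rewrite truncn_le.
  have : - ln r <= Num.max 0 (- ln r) by rewrite le_max lexx orbT.
  by rewrite /N /Lg -2!natr1; lra.
pose delta j : R := expR j%:R ^+ m.+1 * eps / l.
have delta0 j : 0 < delta j by rewrite divr_gt0// mulr_gt0// exprn_gt0// expR_gt0.
pose a (j : nat) : R := A * expR (- j%:R).
have a0 j : 0 <= a j by rewrite mulr_ge0 ?expR_ge0.
pose g u := \sum_(j < N.+1) a j * (2 * lorentz (delta j) u).
have cg : continuous g.
  move=> u; apply: cvg_big; first exact: add_continuous.
  move=> j _; apply: cvgM; first exact: cvg_cst.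
  by apply: cvgM; [exact: cvg_cst|exact: continuous_lorentz].
have gM u : `|g u| <= \sum_(j < N.+1) a j * 2.
  rewrite (le_trans (ler_norm_sum _ _ _))//; apply: ler_sum => j _.
  rewrite normrM ger0_norm// ler_wpM2l// normrM ger0_norm//.
  by rewrite ler_piMr// normr_lorentz_le1.
rewrite (_ : 2 * (C' + 8 * A * C) * v * Lg r ^+ k.+1 =
  2 * (C' * v * Lg r ^+ k.+1 + 8 * A * C * v * Lg r ^+ k.+1)); last by ring.
apply: (@le_trans _ _ (2 * (C' * v + 8 * A * C * v * Lg r ^+ k.+1))); last first.
  rewrite ler_pM2l// lerD2r ler_peMr ?exprn_ege1// mulr_ge0 ?(ltW v0)//; lra.
apply: (@normr_Rintegral_le_average R n P i f l dphi g (C' * v)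
  (8 * A * C * v * Lg r ^+ k.+1) _ l0 (Pl i) cdphi dphi1 cg gM).
- move=> x s b G H sb bl GE HE.
  apply: (@increment_le_cascade R n m x f i N C' A l eps v La s b dphi) => //.
  + by rewrite vr divfK// gt_eqF.
  + have : La <= expR N%:R * eps.
      rewrite -ler_pdivrMr//.
      have -> : La / eps = expR (- ln r).
        by rewrite expRN lnK ?posrE// invf_div.
      by rewrite ler_expR /N ltW// truncnS_gt.
    move/le_trans; apply; rewrite ler_wpM2r ?(ltW eps0)//.
    by rewrite ler_eXnr// -expR0 ler_expR.
  + move=> M u M0 u0 epsM ex.
    apply: (hC' (coord_poly f i x) phi dphi G eps s l s b M u) => //.
    by apply: size_coord_poly => j /fdm[].
- move=> s sl.
  set Q := product_probability _.
  have mL j := measurable_comp_mpoly_fun (mderiv i f) (@continuous_lorentz R (delta j)).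
  have iL j : Q.-integrable setT (EFin \o (fun x =>
      a j * (2 * lorentz (delta j) (mpoly_fun (mderiv i f) x)))).
    apply: (bounded_integrable (M := a j * 2) Q measurableT).
      by apply: measurable_funM => //; apply: measurable_funM => //; exact: mL.
    move=> x; rewrite normrM ger0_norm// ler_wpM2l// normrM ger0_norm//.
    by rewrite ler_piMr// normr_lorentz_le1.
  have term_le j : \int[Q]_x
      (a j * (2 * lorentz (delta j) (mpoly_fun (mderiv i f) x))) <=
      4 * A * C * v * Lg r ^+ k.
    have iLo : Q.-integrable setT (EFin \o (fun x =>
        lorentz (delta j) (mpoly_fun (mderiv i f) x))).
      apply: (bounded_integrable (M := 1) Q measurableT (mL j)).
      by move=> x; exact: normr_lorentz_le1.
    have -> : \int[Q]_x (a j * (2 * lorentz (delta j) (mpoly_fun (mderiv i f) x)))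
        = a j * 2 * \int[Q]_x lorentz (delta j) (mpoly_fun (mderiv i f) x).
      by rewrite -RintegralZl//; apply: eq_Rintegral => x _; rewrite mulrA.
    have := oscillation_bound_lorentz IH l0 (spread_updP i sl Pl) c0 f'dm f'c
      (delta0 j).
    have -> : 2 * delta j / (l ^+ d * c) = 2 * (expR j%:R * v) ^+ m.+1.
      rewrite exprMn vr /delta /r /La (exprS l d).
      by field; rewrite !gt_eqF// exprn_gt0.
    have ev0 : 0 <= expR j%:R * v by rewrite mulr_ge0 ?expR_ge0// ltW.
    have h1 := powR_root2 m ev0.
    (* The ratio at threshold [j] is at least [r], so its logarithmic factor is no larger. *)
    have h2 : Lg (2 * (expR j%:R * v) ^+ m.+1) ^+ k <= Lg r ^+ k.
      rewrite lerXn2r ?nnegrE//; first by rewrite (le_trans ler01)// Lg_ge1.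
      apply: Lg_anti => //; rewrite exprMn vr mulrA ler_peMl ?(ltW r0)//.
      rewrite mulr_ege1 ?exprn_ege1//; first lra.
      by rewrite -expR0 ler_expR.
    move=> h3.
    have h4 : C * (2 * (expR j%:R * v) ^+ m.+1) `^ m.+1%:R^-1 *
        Lg (2 * (expR j%:R * v) ^+ m.+1) ^+ k <=
        C * (2 * (expR j%:R * v)) * Lg r ^+ k.
      apply: ler_pM => //; first by rewrite mulr_ge0// powR_ge0.
        by rewrite exprn_ge0// (le_trans ler01)// Lg_ge1.
      by rewrite ler_wpM2l.
    have := ler_wpM2l _ (le_trans h3 h4) => /(_ (a j * 2)).
    rewrite mulr_ge0// => /(_ isT) /le_trans; apply.
    (* The weight [expR (- j)] cancels the growth [expR j] of the root: the bound is the same for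
       all [j]. *)
    rewrite le_eqVlt; apply/predU1P; left; rewrite /a expRN.
    by field; rewrite gt_eqF// expR_gt0.
  have -> : \int[Q]_x g (mpoly_fun (mderiv i f) x) = \sum_(j < N.+1) \int[Q]_x
      (a j * (2 * lorentz (delta j) (mpoly_fun (mderiv i f) x))).
    exact: (Rintegral_sum N.+1 iL).
  apply: (@le_trans _ _ (\sum_(j < N.+1) 4 * A * C * v * Lg r ^+ k)).
    by apply: ler_sum => j _; exact: term_le.
  rewrite sumr_const card_ord -[_ *+ N.+1]mulr_natr (exprS (Lg r)).
  rewrite (_ : 8 * A * C * v * (Lg r * Lg r ^+ k) =
    4 * A * C * v * Lg r ^+ k * (2 * Lg r)); last by ring.
  rewrite ler_wpM2l// mulr_ge0 ?exprn_ge0// mulr_ge0 ?(ltW v0)//; lra.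
Qed.

End logarithmic_induction.

(** * The modulus of the image measure *)

Section top_coefficient.
Context {R : realType} {n : nat}.
Implicit Types f : mpoly n R.

(** A positive term rules out the default value 0 of the maximum. *)
Lemma bigmax_attained (I : eqType) (s : seq I) (p : pred I) (F : I -> R) :
  (exists2 j, j \in s & p j && (0 < F j)) ->
  exists j, [/\ j \in s, p j, F j = \big[Num.max/0]_(j <- s | p j) F j &
    0 < F j].
Proof.
move=> [j0 j0s /andP[pj0 Fj0]].
have : let b := \big[Num.max/0]_(j <- s | p j) F j in
    b = 0 \/ exists j, [/\ j \in s, p j & F j = b].
  rewrite /= big_seq_cond; elim/big_rec: _ => [|j x /andP[js pj] IH]; first by left.
  rewrite /Num.max; case: ifP => _; first exact: IH.
  by right; exists j.
have b0 : 0 < \big[Num.max/0]_(j <- s | p j) F j.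
  apply: lt_le_trans Fj0 _.
  by apply: le_bigmax_seq.
move=> /= [b|[j [js pj E]]]; first by rewrite b ltxx in b0.
by exists j; split=> //; rewrite E.
Qed.

Lemma mpoly_degree_gt0 f : ~ (exists c : R, f = mpolyC n c) ->
  (0 < mpoly_degree f)%N.
Proof.
move=> fc; rewrite lt0n; apply/eqP => f0; apply: fc.
exists (mcoeff mnm0 f); apply/mpolyP => k; rewrite mcoeffC.
case: eqP => [->|/eqP k0]; rewrite ?mulr1// mulr0.
apply: memN_msupp_eq0; apply/negP => kf.
have : (mdeg k <= mpoly_degree f)%N by exact: (leq_bigmax_seq _ kf isT).
by rewrite f0 leqn0 mdeg_eq0 (negbTE k0).
Qed.

Lemma top_coef_normP f : (0 < mpoly_degree f)%N ->
  0 < top_coef_norm f /\ monomial_ge f (mpoly_degree f) (top_coef_norm f).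
Proof.
move=> D0.
have [j0 j0f j0D] : exists2 j, j \in msupp f & mdeg j == mpoly_degree f.
  have : mpoly_degree f = 0%N \/ exists2 j, j \in msupp f & mdeg j == mpoly_degree f.
    rewrite /mpoly_degree.
    suff : (\max_(j <- msupp f) mdeg j)%N = 0%N \/ exists2 j, j \in msupp f &
      mdeg j = (\max_(j <- msupp f) mdeg j)%N by case=> [->|[j jf E]];
      [left|right; exists j => //; exact/eqP].
    rewrite big_seq; elim/big_rec: _ => [|j x jf IH]; first by left.
    rewrite /maxn; case: ifP => _; first exact: IH.
    by right; exists j.
  by case=> [D|]; first by rewrite D in D0.
have [|j [jf /eqP jD E F0]] := @bigmax_attained _ (msupp f)
  (fun j => mdeg j == mpoly_degree f) (fun j => `|mcoeff j f|).
  by exists j0 => //; rewrite j0D normr_gt0 -mcoeff_msupp.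
rewrite /top_coef_norm -E; split => //; by exists j.
Qed.

(** The induction needs the exact total degree, which may be smaller than [d] and even than [m]. *)
Lemma mpoly_dm_degree d m f : mpoly_dm d m f ->
  mpoly_dm (mpoly_degree f) (minn m (mpoly_degree f)) f.
Proof.
move=> fdm j jf; have jD : (mdeg j <= mpoly_degree f)%N.
  exact: (leq_bigmax_seq _ jf isT).
split => // i; rewrite leq_min; have [_ -> /=] := fdm _ jf.
by apply: leq_trans jD; rewrite mdegE (bigD1 i)//= leq_addr.
Qed.

Lemma mpoly_degree_le d m f : mpoly_dm d m f -> (mpoly_degree f <= d)%N.
Proof. by move=> fdm; apply/bigmax_leqP_seq => j /fdm[]. Qed.

End top_coefficient.

(** * From oscillation bounds to the modulus *)

Section sigma.
Context {R : realType}.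

Lemma expr1D_le (x : R) k : 0 <= x -> (1 + x) ^+ k <= 2 ^+ k * (x ^+ k + 1).
Proof.
move=> x0; have [x1|x1] := leP x 1.
  rewrite -[leLHS]mulr1; apply: ler_pM => //; rewrite ?exprn_ge0//; first lra.
    by rewrite lerXn2r ?nnegrE//; lra.
  by rewrite lerDr exprn_ge0.
rewrite (@le_trans _ _ ((2 * x) ^+ k))//.
  by rewrite lerXn2r ?nnegrE//; lra.
by rewrite exprMn ler_wpM2l ?exprn_ge0// lerDl.
Qed.

Lemma sigma_modulus_le n (P : 'I_n -> probability (measurableTypeR R) R)
    (f : mpoly n R) (eps X : R) :
  (forall phi dphi : R -> R, (forall u : R, is_derive u 1 phi (dphi u)) ->
    continuous dphi -> (forall u, `|phi u| <= eps) ->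
    (forall u, `|dphi u| <= 1) ->
    `|\int[product_probability P]_x dphi (mpoly_fun f x)| <= X) ->
  (sigma_modulus (distribution (product_probability P) (mpoly_fun f)) eps
    <= X%:E)%E.
Proof.
move=> hX; apply: ge_ereal_sup => _ [phi [[dphi _] phie dphi1] <-].
have phi_le u : `|phi u| <= eps.
  by rewrite -lee_fin; apply: le_trans phie; apply: ereal_sup_ubound; exists u.
have dphi_le u : `|derive1 phi u| <= 1.
  by rewrite -lee_fin; apply: le_trans dphi1; apply: ereal_sup_ubound; exists u.
have phiE (u : R) : is_derive u 1 phi (derive1 phi u).
  by apply: DeriveDef; [exact: (dphi 0%N)|rewrite derive1E].
have cd : continuous (derive1 phi).
  move=> u; apply/differentiable_continuous/derivable1_diffP.
  exact: (dphi 1%N).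
have mf := measurable_comp_mpoly_fun f cd.
have iF : (product_probability P).-integrable setT
    (EFin \o (fun x => derive1 phi (mpoly_fun f x))).
  exact: (bounded_integrable _ measurableT mf (fun x => dphi_le _)).
have mE : measurable_fun setT (EFin \o derive1 phi).
  by apply/measurable_EFinP; exact: continuous_measurable_fun.
rewrite (@integral_distribution _ _ _ _ _ (product_probability P) (mpoly_fun f) _ mE iF).
rewrite -(fineK (integrable_fin_num measurableT iF)) lee_fin.
exact: le_trans (ler_norm _) (hX _ _ phiE cd phi_le dphi_le).
Qed.

(* [a] stands for [1 + max BV_norm] and [q] for [eps / top_coef_norm] *)
Lemma final_bound (d D m m' k : nat) (a q C X : R) : (0 < m)%N -> (0 < m')%N ->
  (m' <= m)%N -> (D <= d)%N -> (k <= d - m)%N -> 1 <= a -> 0 < q -> 1 <= C ->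
  X <= 1 -> X <= C * (a ^+ D * q) `^ m'%:R^-1 * Lg (a ^+ D * q) ^+ k ->
  X <= C * 2 ^+ (d - m) * a `^ (d%:R / m%:R) * q `^ m%:R^-1 *
    (`|ln q| ^+ (d - m) + 1).
Proof.
move=> m0 m'0 m'm Dd km a1 q0 C1 X1 XS.
set r := a ^+ D * q in XS *.
have a0 : 0 < a by lra.
have r0 : 0 < r by rewrite mulr_gt0// exprn_gt0.
have C0 : 0 <= C by lra.
have mR : 0 < m%:R :> R by rewrite ltr0n.
have m'R : 0 < m'%:R :> R by rewrite ltr0n.
have w_le : r `^ m%:R^-1 <= a `^ (d%:R / m%:R) * q `^ m%:R^-1.
  rewrite /r powRM ?exprn_ge0 ?(ltW a0) ?(ltW q0)// ler_wpM2r ?powR_ge0//.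
  rewrite -powR_mulrn ?(ltW a0)// -powRrM ler_powR// ler_wpM2r ?invr_ge0 ?(ltW mR)//.
  by rewrite ler_nat.
have L_ge1 : 1 <= `|ln q| ^+ (d - m) + 1 by rewrite lerDr exprn_ge0.
have p2 : 1 <= 2 ^+ (d - m) :> R by rewrite exprn_ege1//; lra.
rewrite -(mulrA (C * _)).
(* For [r >= 1] the right-hand side exceeds 1; for [r < 1] the exponent [1 / m'] can be lowered to
   [1 / m]. *)
have [r1|r1] := leP 1 r.
  apply: (le_trans X1).
  have w1 : 1 <= r `^ m%:R^-1.
    by rewrite -[leLHS](powRr0 r) ler_powR// invr_ge0 ltW.
  by rewrite mulr_ege1// mulr_ege1//; [exact: mulr_ege1|exact: le_trans w_le].
apply: (le_trans XS).
have h1 : r `^ m'%:R^-1 <= r `^ m%:R^-1.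
  apply: ger_powR; first by rewrite r0 ltW.
  by rewrite lef_pV2// ler_nat.
have h2 : Lg r ^+ k <= 2 ^+ (d - m) * (`|ln q| ^+ (d - m) + 1).
  (* As [a >= 1], the factor [Lg r] is at most [Lg q], which no longer involves the densities. *)
  have qr : q <= r by rewrite ler_peMl ?(ltW q0)// exprn_ege1.
  have Lr : Lg r <= 1 + `|ln q|.
    rewrite (le_trans (Lg_anti q0 qr))// /Lg lerD2l ge_max normr_ge0 /=.
    by rewrite -normrN ler_norm.
  apply: le_trans (expr1D_le _ (normr_ge0 _)).
  rewrite (@le_trans _ _ ((1 + `|ln q|) ^+ k))//.
    by rewrite lerXn2r ?nnegrE// (le_trans ler01)// ?Lg_ge1// lerDl.
  by rewrite ler_weXn2l// lerDl.
have Lk0 : 0 <= Lg r ^+ k by rewrite exprn_ge0// (le_trans ler01)// Lg_ge1.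
have w0 := powR_ge0 r m'%:R^-1.
have := ler_pM w0 Lk0 (le_trans h1 w_le) h2.
move=> /(ler_wpM2l C0); rewrite mulrA => /le_trans; apply.
by rewrite le_eqVlt; apply/predU1P; left; ring.
Qed.

End sigma.

Theorem theorem1p7 (R : realType) (d m : nat) (m_gt0 : (0 < m)%N)
    (le_md : (m <= d)%N) :
  exists C : R,
    forall (n : nat) (n_gt0 : (0 < n)%N)
      (nu : 'I_n -> probability (measurableTypeR R) R)
      (rho : 'I_n -> R -> R)
      (nu_density : forall j, has_density (nu j) (rho j))
      (rho_BV : forall j, is_BV (rho j))
      (f : mpoly n R) (f_dm : mpoly_dm d m f)
      (f_nonconst : ~ exists c : R, f = mpolyC n c)
      (eps : R) (eps_gt0 : 0 < eps),
    (sigma_modulus (distribution (product_probability nu) (mpoly_fun f)) eps <=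
     (C
      * (1 + \big[Num.max/0]_(j < n) fine (BV_norm (rho j)))
          `^ (d%:R / m%:R)
      * top_coef_norm f `^ (- m%:R^-1)
      * eps `^ (m%:R^-1)
      * (`|ln ((top_coef_norm f)^-1 * eps)| ^+ (d - m) + 1))%:E)%E.
Proof.
pose C0 i k : R := sval (cid2 (@oscillation_bound_log R i k)).
have C0_ge1 i k : 1 <= C0 i k by rewrite /C0; case: cid2.
have C0P i k : oscillation_bound (i.+1 + k) i.+1
    (fun r => C0 i k * r `^ i.+1%:R^-1 * Lg r ^+ k) by rewrite /C0; case: cid2.
(* The actual degrees vary with [f]; summing over all possible pairs gives a constant depending only
   on [d] and [m]. *)
pose C := \sum_(i < d.+1) \sum_(k < d.+1) C0 i k.
have C0_le i k : (i <= d)%N -> (k <= d)%N -> C0 i k <= C.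
  move=> id kd; rewrite /C (bigD1 (Ordinal (id : (i < d.+1)%N)))//=.
  rewrite (bigD1 (Ordinal (kd : (k < d.+1)%N)))//= -addrA lerDl addr_ge0//.
    by apply: sumr_ge0 => j _; rewrite (le_trans ler01).
  by apply: sumr_ge0 => j _; apply: sumr_ge0 => j' _; rewrite (le_trans ler01).
exists (C * 2 ^+ (d - m)) => n _ nu rho dens bv f fdm fc eps eps0.
set B := \big[Num.max/0]_(j < n) _.
have B0 : 0 <= B by exact: bigmax_ge_id.
(* At this scale [l * B <= 1], as [spread_BV] requires. *)
pose l := (1 + B)^-1.
have B1 : 0 < 1 + B by lra.
have l0 : 0 < l by rewrite invr_gt0.
have sp j : spread l (nu j).
  apply: (spread_BV (B := B) l0 _ (dens j) (bv j)).
    by rewrite /l mulrC ler_pdivrMr//; lra.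
  exact: (le_bigmax 0 (fun j => fine (BV_norm (rho j))) j).
have D0 := mpoly_degree_gt0 fc.
have [c0 fcoef] := top_coef_normP D0.
have fDm := mpoly_dm_degree fdm.
have Dd := mpoly_degree_le fdm.
move: (mpoly_degree f) (top_coef_norm f) D0 c0 fcoef fDm Dd.
move=> D c D0 c0 fcoef fDm Dd.
have [i m'E] : exists i, minn m D = i.+1.
  by exists (minn m D).-1; rewrite prednK// leq_min m_gt0.
(* The excess [k] is [D - m] if [m <= D] and 0 otherwise, so at most [d - m]. *)
have [k DE] : exists k, D = (i.+1 + k)%N.
  by exists (D - i.+1)%N; rewrite subnKC// -m'E geq_minr.
have kdm : (k <= d - m)%N by move: m'E; rewrite /minn; case: ifP => ? ?; lia.
rewrite m'E in fDm.
have q0 : 0 < c^-1 * eps by rewrite mulr_gt0// invr_gt0.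
have qE : c `^ (- m%:R^-1) * eps `^ m%:R^-1 = (c^-1 * eps) `^ m%:R^-1.
  by rewrite powRM ?invr_ge0 ?(ltW c0) ?(ltW eps0)// 
    -(powR_inv1 (ltW c0)) -powRrM mulN1r.
rewrite -[X in (X * _)%:E]mulrA qE.
apply: sigma_modulus_le => phi dphi phiE cdphi phi_le dphi1.
have id : (i <= d)%N by rewrite (leq_trans _ Dd)// DE; lia.
have kd : (k <= d)%N by rewrite (leq_trans _ Dd)// DE; lia.
have C1 : 1 <= C by exact: le_trans (C0_ge1 i k) (C0_le _ _ id kd).
(* The powers of [l] become the factor [(1 + B) ^+ D], the source of the variation norms in the
   bound. *)
have rE : eps / (l ^+ D * c) = (1 + B) ^+ D * (c^-1 * eps).
  by rewrite invfM -exprVn /l invrK mulrC -mulrA.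
apply: (@final_bound R d D m i.+1 k) => //.
- by rewrite -m'E geq_minl.
- lra.
- by apply: normr_Rintegral_le => //; exact: measurable_comp_mpoly_fun.
rewrite -rE.
rewrite DE in fDm fcoef *.
apply: le_trans (C0P i k n nu f l c eps phi dphi l0 sp c0 fDm fcoef eps0
  phiE cdphi phi_le dphi1) _.
rewrite -!mulrA ler_wpM2r ?C0_le//.
by rewrite mulr_ge0 ?powR_ge0// exprn_ge0// (le_trans ler01)// Lg_ge1.
Qed.
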